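(* Let $\{X(t)\}_{t\ge0}$ be a Markov process on $\mathbb{X}$ with transition kernel $p(t,x,dy)$, and let $\{S(t)\}_{t\ge0}$ be a subordinator with characteristic exponent $\psi$, independent of $\{X(t)\}_{t\ge0}$. Assume that $\{X(t)\}_{t\ge0}$ admits an invariant $\pi\in\mathcal{P}(\mathbb{X})$ such that $\mathcal{W}_p(\delta_xP_t,\pi)\le c(x)\,r(t)$ for some $p\ge1$ and all $t\ge0$ and $x\in\mathbb{X}$, where $r\colon[0,\infty)\to[1,\infty)$ is Borel measurable and $c\colon\mathbb{X}\to[0,\infty)$. Then $$\mathcal{W}_p(\delta_xP_t^\psi,\pi)\le c(x)\,r_\psi(t)\qquad\forall(t,x)\in[0,\infty)\times\mathbb{X},$$ where $r_\psi(t):=\left(\mathbb{E}\left[r(S(t))^p\right]\right)^{1/p}$.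
   Context: $\mathbb{X}$ is a locally compact separable completely metrizable space with metric $\mathsf{d}$ and Borel $\sigma$-algebra. $\{X(t)\}_{t\ge0}$ is a time-homogeneous conservative strong Markov process on $\mathbb{X}$ with càdlàg paths, laws $\mathbb{P}_x$ with $\mathbb{P}_x(X(0)=x)=1$, and $p(t,x,dy)=\mathbb{P}_x(X(t)\in dy)=\delta_xP_t(dy)$. A measure $\pi$ is invariant if $\int p(t,x,dy)\,\pi(dx)=\pi(dy)$ for all $t\ge0$. A subordinator $\{S(t)\}_{t\ge0}$ is a nondecreasing Lévy process on $[0,\infty)$ with $\mathbb{E}[e^{-uS(t)}]=e^{-t\psi(u)}$; its characteristic (Laplace) exponent $\psi$ is a Bernstein function $\psi(u)=b_Su+\int_{(0,\infty)}(1-e^{-uy})\,\nu_S(dy)$, with $b_S\ge0$ and $\int_{(0,\infty)}(1\wedge y)\,\nu_S(dy)<\infty$. The subordinate process is $X^\psi(t)=X(S(t))$, a Markov process with transition kernel $p^\psi(t,x,dy)=\int_{[0,\infty)}p(s,x,dy)\,\mu_t(ds)$, where $\mu_t=\mathbb{P}(S(t)\in\cdot)$; $\delta_xP_t^\psi(dy)=p^\psi(t,x,dy)$. $\mathcal{P}(\mathbb{X})$ is the set of Borel probability measures, and $\mathcal{W}_p(\mu_1,\mu_2)=\inf_\Pi\left(\int\mathsf{d}(x,y)^p\,\Pi(dx,dy)\right)^{1/p}$ over couplings $\Pi$ of $\mu_1,\mu_2$. *)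

(* Defs.v *)
From HB Require Import structures.
From mathcomp Require Import all_boot all_order all_algebra.
From mathcomp Require Import all_classical all_reals all_analysis.
From mathcomp Require Import measurable_realfun.

Set Implicit Arguments.
Unset Strict Implicit.
Unset Printing Implicit Defensive.

Import Order.TTheory GRing.Theory Num.Theory.
Import numFieldNormedType.Exports.

Local Open Scope classical_set_scope.
Local Open Scope ring_scope.

HB.mixin Record isBorel d (R : numDomainType) T
    & Metric R T & Measurable d T := {
  measurableEopen : @measurable d T = <<s @open T >> }.

#[short(type="borelMetricType")]
HB.structure Definition BorelMetric d (R : numDomainType) :=
  {T of Metric R T & Measurable d T & isBorel d R T}.

Definition separable_space (T : topologicalType) : Prop :=
  exists2 D : set T, countable D & dense D.

(* The complete metric is only required to induce the topology; it need not be
   the given metric of T. *)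
Definition completely_metrizable (R : realType) (T : topologicalType) : Prop :=
  exists d : T -> T -> R,
    [/\ forall x y, d x y = 0 <-> x = y,
        forall x y, d x y = d y x,
        forall x y z, d x z <= d x y + d y z,
        forall x (A : set T),
          nbhs x A <-> exists2 e : R, 0 < e & [set y | d x y < e] `<=` A
      & forall u : nat -> T,
          (forall e : R, 0 < e -> exists N, forall m n,
             (N <= m)%N -> (N <= n)%N -> d (u m) (u n) < e) ->
          exists l : T, u n @[n --> \oo] --> l].

Definition cadlag (R : realType) (T : topologicalType) (f : R -> T) : Prop :=
  (forall t : R, 0 <= t -> f s @[s --> t^'+] --> f t) /\
  (forall t : R, 0 < t -> exists l : T, f s @[s --> t^'-] --> l).

Section wasserstein.
Context d (R : realType) (T : borelMetricType d R).
Local Open Scope ereal_scope.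

Definition coupling (m1 m2 : set T -> \bar R) (Pi : probability (T * T)%type R)
    : Prop :=
  forall A : set T, measurable A ->
    Pi (fst @^-1` A) = m1 A /\ Pi (snd @^-1` A) = m2 A.

Definition wasserstein (p : R) (m1 m2 : set T -> \bar R) : \bar R :=
  ereal_inf [set (\int[Pi]_z ((mdist z.1 z.2) `^ p)%:E) `^ p^-1
            | Pi in coupling m1 m2].

End wasserstein.

Section markov.
Context d dO (R : realType) (T : borelMetricType d R) (Omega : measurableType dO).
Implicit Types (F : R -> set (set Omega)) (P : T -> probability Omega R)
  (X : R -> {mfun Omega >-> T}).

Definition filtration F : Prop :=
  [/\ forall t : R, 0 <= t -> sigma_algebra setT (F t),
      forall t : R, 0 <= t -> F t `<=` measurable
    & forall s t : R, 0 <= s -> s <= t -> F s `<=` F t].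

Definition stopping_time F (tau : Omega -> \bar R) : Prop :=
  (forall w, 0 <= tau w)%E /\
  (forall t : R, 0 <= t -> F t [set w | (tau w <= t%:E)%E]).

Definition stopped_sigma_algebra F (tau : Omega -> \bar R) : set (set Omega) :=
  [set A | measurable A /\
           forall t : R, 0 <= t -> F t (A `&` [set w | (tau w <= t%:E)%E])].

(* p(t, x, dy) *)
Definition transition P X (t : R) (x : T) : probability T R :=
  distribution (P x) (X t).

(* The index set of all processes is [0, +oo[, so X t is irrelevant for t < 0.
   Conservativeness is built in: X t is T-valued, hence p(t, x, T) = 1. *)
Record strong_markov_process P X F : Prop := {
  markov_filtration : filtration F ;
  markov_adapted : forall t : R, 0 <= t ->
    forall B, measurable B -> F t (X t @^-1` B) ;
  markov_start : forall x, P x (X 0 @^-1` [set x]) = 1%E ;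
  markov_cadlag : forall w, cadlag (fun t => X t w) ;
  markov_measurable : forall t : R, 0 <= t -> forall B, measurable B ->
    measurable_fun setT (fun x => transition P X t x B) ;
  markov_strong : forall x (tau : Omega -> \bar R), stopping_time F tau ->
    forall A, stopped_sigma_algebra F tau A ->
    forall s : R, 0 <= s -> forall B, measurable B ->
    P x (A `&` [set w | (tau w < +oo)%E] `&`
         [set w | B (X (fine (tau w) + s) w)]) =
    (\int[P x]_(w in A `&` [set w | (tau w < +oo)%E])
        transition P X s (X (fine (tau w)) w) B)%E }.

Definition invariant_measure P X (pi : probability T R) : Prop :=
  forall t : R, 0 <= t -> forall B, measurable B ->
    (\int[pi]_x transition P X t x B)%E = pi B.

End markov.

Section subordinator.
Context dS (R : realType) (OmegaS : measurableType dS)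
  (Q : probability OmegaS R).
Implicit Types (S : R -> {RV Q >-> R}) (psi : R -> R).

Definition stationary_increments S : Prop :=
  forall s t : R, 0 <= s -> s <= t -> forall B : set R, measurable B ->
    Q [set w | B (S t w - S s w)] = Q [set w | B (S (t - s) w)].

(* Taking some of the B i to be the whole line gives the product rule for every
   subfamily of the increments. *)
Definition independent_increments S : Prop :=
  forall (n : nat) (t : nat -> R),
    0 <= t 0%N -> {homo t : i j / (i <= j)%N >-> i <= j} ->
  forall B : 'I_n -> set R, (forall i, measurable (B i)) ->
    Q (\bigcap_i [set w | B i (S (t i.+1) w - S (t i) w)]) =
    (\prod_(i < n) Q [set w | B i (S (t i.+1) w - S (t i) w)%R])%E.

Record subordinator S : Prop := {
  subordinator_ge0 : forall t : R, 0 <= t -> forall w, 0 <= S t w ;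
  subordinator0 : {ae Q, forall w, S 0 w = 0} ;
  subordinator_independent : independent_increments S ;
  subordinator_stationary : stationary_increments S ;
  subordinator_cadlag : {ae Q, forall w, cadlag (fun t => S t w)} ;
  subordinator_nondecreasing :
    {ae Q, forall w, forall s t : R, 0 <= s -> s <= t -> S s w <= S t w} }.

(* Bernstein functions without killing term; nu is only evaluated on
   ]0, +oo[. *)
Definition bernstein psi : Prop :=
  exists (b : R) (nu : {measure set R -> \bar R}),
    [/\ 0 <= b,
        (\int[nu]_(y in `]0%R, +oo[) (Num.min 1 y)%:E < +oo)%E
      & forall u : R, 0 <= u -> ((psi u)%:E = (b * u)%:E +
          \int[nu]_(y in `]0%R, +oo[) (1 - expR (- (u * y)))%:E)%E].

Definition characteristic_exponent S psi : Prop :=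
  bernstein psi /\
  forall t u : R, 0 <= t -> 0 <= u ->
    ('E_Q[fun w => expR (- (u * S t w))] = (expR (- (t * psi u)))%:E)%E.

(* r_psi(t); the value +oo is allowed. *)
Definition subordinate_rate S (p : R) (r : R -> R) (t : R) : \bar R :=
  ('E_Q[fun w => (r (S t w) `^ p)%R] `^ p^-1)%E.

End subordinator.

Section subordination.
Context d dO dS (R : realType) (T : borelMetricType d R)
  (Omega : measurableType dO) (OmegaS : measurableType dS)
  (Q : probability OmegaS R).
Implicit Types (P : T -> probability Omega R) (X : R -> {mfun Omega >-> T})
  (F : R -> set (set Omega)) (S : R -> {RV Q >-> R}).

(* The mixture of the p(s, x, dy) by mu_t, the law of S t, as a set function;
   subordinate_transitionE below identifies it with a law. *)
Definition subordinate_transition P X S (t : R) (x : T) (B : set T) : \bar R :=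
  (\int[distribution Q (S t)]_(s in `[0%R, +oo[) transition P X s x B)%E.

Let disc (n : nat) (s : R) : R :=
  ((Num.truncn (s * n.+1%:R)).+1%:R / n.+1%:R).

Let disc_cvg (s : R) : 0 <= s -> disc n s @[n --> \oo] --> s^'+.
Proof.
move=> s0 A [e /= e0 eA].
have := near_infty_natSinv_lt (PosNum e0); apply: filterS => n /= ne.
have n0 : 0 < n.+1%:R :> R by rewrite ltr0n.
have /andP[h1 h2] : ((Num.truncn (s * n.+1%:R))%:R <= s * n.+1%:R <
    (Num.truncn (s * n.+1%:R)).+1%:R) by rewrite truncn_itv// mulr_ge0// ltW.
have sd : s < disc n s by rewrite /disc ltr_pdivlMr.
apply: eA => //=; rewrite distrC gtr0_norm ?subr_gt0//.
apply: le_lt_trans ne; rewrite lerBlDl /disc ler_pdivrMr// mulrDl mulVf ?gt_eqF//.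
by rewrite -natr1 lerD2r.
Qed.

Lemma measurable_random_time d' (T' : measurableType d') (sigma : T' -> R) P X F :
  strong_markov_process P X F ->
  measurable_fun setT sigma -> (forall v, 0 <= sigma v) ->
  measurable_fun setT (fun z : Omega * T' => X (sigma z.2) z.1).
Proof.
move=> mX ms s0.
pose Y (z : Omega * T') : T := X (sigma z.2) z.1.
pose Yn n (z : Omega * T') : T := X (disc n (sigma z.2)) z.1.
have mYn n B : measurable B -> measurable (Yn n @^-1` B).
  move=> mB.
  have -> : Yn n @^-1` B = \bigcup_k
      ((X (k.+1%:R / n.+1%:R) @^-1` B) `*`
       (sigma @^-1` `[k%:R / n.+1%:R, k.+1%:R / n.+1%:R[)).
    have n0 : 0 < n.+1%:R :> R by rewrite ltr0n.
    have E v k : (sigma v \in `[k%:R / n.+1%:R, k.+1%:R / n.+1%:R[) =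
        (Num.truncn (sigma v * n.+1%:R) == k).
      have sn0 : 0 <= sigma v * n.+1%:R by rewrite mulr_ge0// ltW.
      by rewrite truncn_eq// in_itv/= ler_pdivrMr// ltr_pdivlMr.
    apply/seteqP; split => [[w v] /= h|[w v] [k _] [/= h]].
      by exists (Num.truncn (sigma v * n.+1%:R)) => //; split => //=; rewrite E.
    by rewrite E => /eqP kE; rewrite /Yn/= /disc kE.
  apply: bigcupT_measurable => k; apply: measurableX.
    by rewrite -[X in measurable X]setTI; exact: measurable_funP.
  by rewrite -[X in measurable X]setTI; apply: ms.
have Ycvg z : Yn n z @[n --> \oo] --> Y z.
  have [/(_ _ (s0 z.2)) h _] := markov_cadlag mX z.1.
  exact: cvg_comp (disc_cvg (s0 z.2)) h.
apply: (@measurability _ _ _ _ setT Y (@open T)); first exact: measurableEopen.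
move=> _ [U oU <-]; rewrite setTI.
pose e (m : nat) : R := m.+1%:R^-1.
pose C m := ~` \bigcup_(z in ~` U) [set y : T | (mdist z y < e m)].
have mC m : measurable (C m).
  apply: measurableC; rewrite measurableEopen; apply: sub_sigma_algebra.
  apply: bigcup_open => z _; rewrite openE => y /= zy.
  apply/metricType_numDomainType.nbhs_mdistP.
  exists (e m - mdist z y) => /=; first by rewrite subr_gt0.
  move=> u /= yu; apply: le_lt_trans (metric_triangle z y u) _.
  by rewrite -ltrBrDl.
have e0 m : 0 < e m by rewrite invr_gt0 ltr0n.
have -> : Y @^-1` U = \bigcup_m \bigcup_N \bigcap_(n >= N) Yn n @^-1` C m.
  apply/seteqP; split => z /=.
    move=> Uz; have : nbhs (Y z) U by exact: open_nbhs_nbhs.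
    move/metricType_numDomainType.nbhs_mdistP => [a /= a0 aU].
    have [m ma] : exists m, (e m < a / 2).
      have [m _ /(_ m (leqnn m)) h] :=
        near_infty_natSinv_lt (PosNum (divr_gt0 a0 (ltr0n R 2))).
      by exists m.
    have : nbhs (Y z) [set y | (mdist (Y z) y < a / 2)].
      apply/metricType_numDomainType.nbhs_mdistP.
      by exists (a / 2) => //=; rewrite divr_gt0.
    move/(Ycvg z) => [N _ hN].
    exists m => //; exists N => // n /= Nn [u nUu] /= uY; apply: nUu.
    apply: aU => /=; apply: le_lt_trans (metric_triangle _ (Yn n z) _) _.
    rewrite [ltRHS]splitr ltrD//; first exact: hN.
    by rewrite metric_sym (lt_trans uY).
  move=> [m _ [N _ h]].
  have : nbhs (Y z) [set y | (mdist (Y z) y < e m)].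
    by apply/metricType_numDomainType.nbhs_mdistP; exists (e m) => /=.
  move/(Ycvg z) => [M _ hM].
  apply: contrapT => nU.
  apply: (h (maxn N M)); first by rewrite /= leq_maxl.
  by exists (Y z) => //=; apply: hM; rewrite /= leq_maxr.
apply: bigcupT_measurable => m; apply: bigcupT_measurable => N.
apply: bigcap_measurable; first by exists N => /=.
by move=> n _; exact: mYn.
Qed.

Lemma measurable_transition P X F (x : T) (B : set T) :
  strong_markov_process P X F -> measurable B ->
  measurable_fun (`[0, +oo[%classic : set R) (fun s : R => transition P X s x B).
Proof.
move=> mX mB.
pose m0 (s : R) : R := Num.max 0 s.
have mm0 : measurable_fun setT m0 by exact: measurable_maxr.
have m00 s : 0 <= m0 s by rewrite le_max lexx.
have mY := measurable_random_time mX mm0 m00.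
have mA : measurable ((fun z : Omega * R => X (m0 z.2) z.1) @^-1` B).
  by rewrite -[X in measurable X]setTI; exact: mY.
have h := measurable_fun_ysection (P x) mA.
apply: (eq_measurable_fun _ _ (measurable_funTS h)) => s.
rewrite inE/= in_itv/= andbT => s0.
rewrite /transition /distribution /pushforward /=; congr (P x _).
apply/seteqP; split => w; rewrite /ysection/= inE/= /m0 (max_idPr _)//.
Qed.

(* S is independent of X: the pair lives on the product of the two probability
   spaces, and p^psi(t, x, dy) is the law of X(S(t)) under P_x. *)
Lemma subordinate_transitionE P X F S (t : R) (x : T) (B : set T) :
  strong_markov_process P X F -> subordinator S -> 0 <= t -> measurable B ->
  subordinate_transition P X S t x B =
  (P x \x Q)%E [set z | B (X (S t z.2) z.1)].
Proof.
move=> mX sS t0 mB.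
have mY := measurable_random_time mX (measurable_funP (S t))
  (subordinator_ge0 sS t0).
have mA : measurable [set z : Omega * OmegaS | B (X (S t z.2) z.1)].
  by rewrite -[X in measurable X]setTI; exact: mY.
have -> : (P x \x Q)%E [set z | B (X (S t z.2) z.1)] =
    (P x \x^ Q)%E [set z | B (X (S t z.2) z.1)].
  by apply: product_measure_unique => //= ? ? ? ?; rewrite product_measure2E.
rewrite /subordinate_transition /distribution ge0_integral_pushforward//=; last first.
  exact: measurable_transition mX mB.
have -> : S t @^-1` `[0, +oo[ = setT.
  by apply/seteqP; split => // w _ /=; rewrite in_itv/= (subordinator_ge0 sS).
apply: eq_integral => v _ /=; rewrite /transition /distribution /pushforward.
congr (P x _); apply/seteqP; split => w; rewrite /ysection/= inE//.
Qed.

End subordination.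

(* Main.v *)
Require Import Defs.
From HB Require Import structures.
From mathcomp Require Import all_boot all_order all_algebra.
From mathcomp Require Import all_classical all_reals all_analysis.
From mathcomp Require Import measurable_realfun.
From mathcomp Require Import ring lra.

(* Averaging near-optimal couplings of p(s, x, dy) and pi over the law of S t
   would require a measurable selection of couplings. This is avoided by
   discretization. Cut T into countably many cells of small diameter, and cut
   the sample space of S into countably many measurable pieces, on each of which
   the masses of the cells under p(S t, x, dy) are bounded below by one rational
   profile, up to a residue of small p-th moment, while the bound c x * r (S t)
   varies little. The conditions are linear in the measure, so the average m of
   p(S t, x, dy) over a piece satisfies them too. Hence m is close to any single
   p(s, x, dy) of that piece, and gluing yields one coupling of m and pi per
   piece; the mixture of these countably many couplings is the required one.
   The p-th moments are finite by the rate at time 0, where p(0, x, dy) is the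
   Dirac mass at x. *)

Set Implicit Arguments.
Unset Strict Implicit.
Unset Printing Implicit Defensive.

Import Order.TTheory GRing.Theory Num.Theory.
Import numFieldNormedType.Exports.

Local Open Scope classical_set_scope.
Local Open Scope ring_scope.

(** * Mixtures of measures, densities and images *)

Section mixture.
Local Open Scope ereal_scope.
Context d1 d2 (R : realType) (Y : measurableType d1) (Z : measurableType d2).
Variables (nu : {measure set Y -> \bar R}) (k : Y -> {measure set Z -> \bar R}).

(** The measurability proof is an argument so that the measure structure declared below can be
    attached to the term [mixture mk]. *)
Definition mixture of (forall A, measurable A -> measurable_fun setT (k ^~ A)) :
    set Z -> \bar R :=
  fun A => \int[nu]_y k y A.

Hypothesis mk : forall A, measurable A -> measurable_fun setT (k ^~ A).

Let mix := mixture mk.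

Let mix0 : mix set0 = 0.
Proof. by rewrite /mix /mixture integral0_eq. Qed.

Let mix_ge0 A : 0 <= mix A.
Proof. exact: integral_ge0. Qed.

Let mix_sigma_additive : semi_sigma_additive mix.
Proof.
move=> F mF tF _; rewrite /mix /mixture.
rewrite [X in _ --> X](_ : _ = \int[nu]_y \sum_(n <oo) k y (F n)); last first.
  apply: eq_integral => y _; apply/esym/cvg_lim => //.
  exact: measure_sigma_additive.
rewrite integral_nneseries//; last by move=> n; exact: mk.
by apply: is_cvg_nneseries => n _ _; exact: integral_ge0.
Qed.

HB.instance Definition _ :=
  isMeasure.Build _ _ _ mix mix0 mix_ge0 mix_sigma_additive.

Import HBNNSimple.

(** For an indicator this is the definition of the mixture. Linearity extends it to simple
    functions, and monotone convergence, applied once in [Z] and once in [Y], to nonnegative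
    measurable [f]. *)
Lemma integral_mixture (f : Z -> \bar R) :
  measurable_fun setT f -> (forall z, 0 <= f z) ->
  \int[mixture mk]_z f z = \int[nu]_y \int[k y]_z f z.
Proof.
move=> mf f0; pose g := nnsfun_approx measurableT mf.
have nd_g z : {homo (fun n => (g n z)%:E) : m n / (m <= n)%O >-> m <= n}.
  by move=> m n mn; rewrite lee_fin; exact/lefP/nd_nnsfun_approx.
have step (m : {measure set Z -> \bar R}) :
    \int[m]_z f z = limn (fun n => sintegral m (g n)).
  transitivity (\int[m]_z limn (fun n => (g n z)%:E)).
    by apply: eq_integral => z _; apply/esym/cvg_lim => //; exact: cvg_nnsfun_approx.
  rewrite monotone_convergence//; last 2 first.
  - by move=> n; exact/measurable_EFinP.
  - by move=> n z _; rewrite lee_fin.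
  by apply/congr_lim/funext => n; rewrite integralT_nnsfun.
have msint n : measurable_fun setT (fun y => sintegral (k y) (g n)).
  under eq_fun do rewrite -integralT_nnsfun.
  apply: measurable_fun_integral_kernel => //; last exact/measurable_EFinP.
  by move=> z; rewrite lee_fin.
rewrite (step mix).
under [RHS]eq_integral do rewrite step.
rewrite monotone_convergence//; last 2 first.
- by move=> n y _; rewrite -integralT_nnsfun; apply: integral_ge0 => z _; rewrite lee_fin.
- move=> y _ m n mn; rewrite -!integralT_nnsfun; apply: ge0_le_integral => //.
  + by move=> z _; rewrite lee_fin.
  + exact/measurable_EFinP.
  + exact/measurable_EFinP.
  + by move=> z _; exact: nd_g.
apply/congr_lim/funext => n; rewrite sintegralE.
under [RHS]eq_integral do rewrite sintegralE.
rewrite ge0_integral_fsum//; last 2 first.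
- by move=> r; apply: measurable_funeM; exact: mk.
- by move=> r y _; exact: nnsfun_mulemu_ge0.
(* The sum ranges over all reals [r]; a negative [r] is not a value of the nonnegative simple
   function [g n], so its term vanishes on both sides. *)
apply: eq_fsbigr => r _; have [r0|r0] := leP 0%R r.
  by rewrite ge0_integralZl//; exact: mk.
rewrite preimage_nnfun0// measure0 mule0 integral0_eq// => y _.
by rewrite measure0 mule0.
Qed.

Lemma mixture_ex : exists m : {measure set Z -> \bar R},
  (forall A, m A = \int[nu]_y k y A) /\
  (forall f : Z -> \bar R, measurable_fun setT f -> (forall z, 0 <= f z) ->
    \int[m]_z f z = \int[nu]_y \int[k y]_z f z).
Proof. by exists mix; split => //; exact: integral_mixture. Qed.

End mixture.

(** The measure of density [g] is the mixture over [nu] of the scaled Dirac masses at [y] of weight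
    [g y]. *)
Lemma density_ex d (R : realType) (Y : measurableType d)
    (nu : {measure set Y -> \bar R}) (g : Y -> R) :
  measurable_fun setT g -> (forall y, 0 <= g y) ->
  exists m : {measure set Y -> \bar R},
    forall f : Y -> \bar R, measurable_fun setT f -> (forall y, 0 <= f y)%E ->
      (\int[m]_y f y = \int[nu]_y ((g y)%:E * f y))%E.
Proof.
move=> mg g0.
pose k y : {measure set Y -> \bar R} := mscale (NngNum (g0 y)) (\d_y)%R.
have mk A : measurable A -> measurable_fun setT (k ^~ A).
  move=> mA; apply: emeasurable_funM; first exact/measurable_EFinP.
  by apply/measurable_EFinP; exact: measurable_indic.
have [m [_ mE]] := mixture_ex nu mk; exists m => f mf f0; rewrite mE//.
apply: eq_integral => y _.
by rewrite ge0_integral_mscale//= integral_dirac// diracT mul1e.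
Qed.

Section probability_of_measure.
Context d (R : realType) (Y : measurableType d).
Variable m : {measure set Y -> \bar R}.

(** As for [mixture], the proof of total mass 1 is carried by the term, so that the probability
    structure can be attached to it. *)
Definition probability_of of m setT = 1%E : set Y -> \bar R := m.

Hypothesis m1 : m setT = 1%E.

Let P := probability_of m1.

HB.instance Definition _ := Measure.on P.

HB.instance Definition _ := Measure_isProbability.Build _ _ _ P m1.

Lemma probability_ex : exists P : probability Y R, P = m :> (set Y -> \bar R).
Proof. by exists P. Qed.

End probability_of_measure.

(** * Functions of a countable measurable index, and measurable selection from countably many
    sets *)

Lemma measurable_fun_index d d' (Y : measurableType d) (Z : measurableType d')
    (i : Y -> nat) (f : nat -> Z) :
  (forall n, measurable (i @^-1` [set n])) -> measurable_fun setT (f \o i).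
Proof.
move=> mi _ B mB; rewrite setTI.
have -> : (f \o i) @^-1` B = \bigcup_(n in f @^-1` B) (i @^-1` [set n]).
  by apply/seteqP; split => [y By|y [n + /= iyn]]; [exists (i y)|rewrite -iyn].
exact: bigcup_measurable.
Qed.

Lemma integral_index d (R : realType) (Y : measurableType d)
    (m : {measure set Y -> \bar R}) (i : Y -> nat) (f : nat -> \bar R) :
  (forall n, measurable (i @^-1` [set n])) -> (forall n, 0 <= f n)%E ->
  (\int[m]_y f (i y) = \sum_(n <oo) f n * m (i @^-1` [set n]))%E.
Proof.
move=> mi f0.
have mfi : measurable_fun setT (f \o i) by exact: measurable_fun_index.
have iT : \bigcup_n (i @^-1` [set n]) = setT.
  by apply/seteqP; split => // y _; exists (i y).
rewrite -{1}iT ge0_integral_bigcup//; first last.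
- by move=> a b _ _ [y [/= <- <-]].
- by rewrite iT.
apply: eq_eseriesr => n _.
transitivity (\int[m]_(y in i @^-1` [set n]) cst (f n) y)%E.
  by apply: eq_integral => y; rewrite inE/= => ->.
by rewrite integral_cst.
Qed.

(** The sets [E n] are made disjoint by removing the earlier ones. A point lies in exactly one of
    the resulting sets, and the index of that set is the selector, whose level sets are therefore
    measurable. *)
Lemma measurable_selector d (Y : measurableType d) (E : nat -> set Y) :
  (forall n, measurable (E n)) -> (forall y, exists n, E n y) ->
  exists2 i : Y -> nat, forall n, measurable (i @^-1` [set n]) &
    forall y, E (i y) y.
Proof.
move=> mE Ex.
have Dx y : exists n, seqDU E n y.
  have : (\bigcup_n E n) y by have [n En] := Ex y; exists n.
  by rewrite seqDU_bigcup_eq => -[n _ h]; exists n.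
pose i y := sval (cid (Dx y)).
have iP y : seqDU E (i y) y by rewrite /i; case: cid.
exists i; last by move=> y; exact: (subset_seqDU (iP y)).
move=> n; suff -> : i @^-1` [set n] = seqDU E n by exact: seqDU_measurable.
apply/seteqP; split => y /= => [<-//|h].
by apply: (@trivIset_seqDU _ E) => //; exists y; split; first exact: iP.
Qed.

Lemma measurable_fun_lt d (R : realType) (Y : measurableType d) (f : Y -> R) :
  (forall e, measurable [set y | f y < e]) -> measurable_fun setT f.
Proof.
move=> mf; apply: (measurability _ (RGenInftyO.measurableE R)) => // _ [_ [e ->] <-].
rewrite setTI (_ : _ @^-1` _ = [set y | f y < e]); first exact: mf.
by apply/seteqP; split => y; rewrite /= in_itv.
Qed.

(** The second hypothesis says that [g] is the pointwise infimum of the [f i], phrased through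
    strict sublevel sets, which become countable unions. *)
Lemma measurable_fun_inf d (R : realType) (Y : measurableType d)
    (f : nat -> Y -> R) (g : Y -> R) :
  (forall i, measurable_fun setT (f i)) ->
  (forall y e, g y < e <-> exists i, f i y < e) -> measurable_fun setT g.
Proof.
move=> mf gP; apply: measurable_fun_lt => e.
have -> : [set y | g y < e] = \bigcup_i (f i @^-1` `]-oo, e[).
  by apply/seteqP; split => [y /gP[i fie]|y [i _]];
    [exists i => //=|rewrite /= => fie; apply/gP; exists i]; rewrite ?in_itv// in fie *.
by apply: bigcupT_measurable => i; rewrite -[X in measurable X]setTI; exact: mf.
Qed.

(** * Measurability of the metric and small cells in a separable metric space *)

Section borel_metric.
Context d (R : realType) (T : borelMetricType d R).

Lemma open_mdist_lt (x : T) (e : R) : open [set y : T | mdist x y < e].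
Proof.
rewrite openE => y /= xy; apply/metricType_numDomainType.nbhs_mdistP.
exists (e - mdist x y) => /=; first by rewrite subr_gt0.
move=> u /= yu; apply: le_lt_trans (metric_triangle x y u) _.
by rewrite -ltrBrDl.
Qed.

Lemma dense_sequence (x0 : T) : separable_space T ->
  exists a : nat -> T, forall x (e : R), 0 < e -> exists i, mdist (a i) x < e.
Proof.
move=> [D /countable_injP[f finj] dD].
(* The injection [f] codes the dense set by integers; [x0] is the value at integers that code no
   point. *)
pose a n := if pselect (exists2 y, D y & f y = n) is left h
  then sval (cid2 h) else x0.
exists a => x e e0.
have [] := dD [set y : T | mdist x y < e].
- by exists x => /=; rewrite mdistxx.
- exact: open_mdist_lt.
move=> y [/= xy Dy]; exists (f y); rewrite /a.
case: pselect => [h|[]]; last by exists y.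
case: cid2 => z /= Dz fz; rewrite metric_sym.
by rewrite (finj z y) ?inE.
Qed.

Lemma measurable_mdist (x : T) : measurable_fun setT (mdist x).
Proof.
apply: measurable_fun_lt => e; rewrite measurableEopen.
by apply: sub_sigma_algebra; exact: open_mdist_lt.
Qed.

(** Measurability with respect to the product sigma-algebra comes from separability: the distance of
    x and y is the infimum of [mdist (a i) x + mdist (a i) y] over a dense sequence [a]. *)
Lemma measurable_fun_mdist d' (Y : measurableType d') (u v : Y -> T) :
  separable_space T -> measurable_fun setT u -> measurable_fun setT v ->
  measurable_fun setT (fun y => mdist (u y) (v y)).
Proof.
move=> sT mu mv; have [[y0 _]|Y0] := pselect (exists y : Y, True); last first.
  by move=> _ B _; rewrite setTI (_ : _ @^-1` _ = set0)//;
    apply/seteqP; split => // y; case: Y0; exists y.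
have [a aP] := dense_sequence (u y0) sT.
apply: (@measurable_fun_inf _ R Y
    (fun i y => mdist (a i) (u y) + mdist (a i) (v y))) => [i|y e].
  by apply: measurable_funD; apply: measurableT_comp => //; exact: measurable_mdist.
move: (u y) (v y) => {}x {}y.
split => [xy|[i]]; last first.
  by apply: le_lt_trans; rewrite (metric_sym (a i) x); exact: metric_triangle.
(* Half of the slack suffices: the distance from [a i] to [x] is counted twice once [mdist (a i) y]
   is bounded through [x]. *)
have [i ai] : exists i, mdist (a i) x < (e - mdist x y) / 2.
  by apply: aP; rewrite divr_gt0// subr_gt0.
exists i; apply: (@le_lt_trans _ _ (mdist (a i) x *+ 2 + mdist x y)).
  by rewrite mulr2n -addrA lerD2l metric_triangle.
by rewrite -ltrBrDr -mulr_natr -ltr_pdivlMr.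
Qed.

Lemma index_of_cells (x0 : T) (e : R) : separable_space T -> 0 < e ->
  exists (a : nat -> T) (i : T -> nat),
    (forall n, measurable (i @^-1` [set n])) /\
    forall x, mdist (a (i x)) x < e.
Proof.
move=> sT e0; have [a aP] := dense_sequence x0 sT.
have [||i mi iP] := @measurable_selector _ T (fun n => [set x | mdist (a n) x < e]).
- move=> n; rewrite measurableEopen; apply: sub_sigma_algebra.
  exact: open_mdist_lt.
- by move=> x; exact: aP.
- by exists a, i.
Qed.

End borel_metric.

Lemma measurable_fun_index2 d d' (Y : measurableType d) (Z : measurableType d')
    (i j : Y -> nat) (f : nat -> nat -> Z) :
  (forall n, measurable (i @^-1` [set n])) ->
  (forall n, measurable (j @^-1` [set n])) ->
  measurable_fun setT (fun y => f (i y) (j y)).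
Proof.
move=> mi mj _ B mB; rewrite setTI.
have -> : (fun y => f (i y) (j y)) @^-1` B =
    \bigcup_k (i @^-1` [set k] `&` (f k \o j) @^-1` B).
  apply/seteqP; split => [y By|y [k _ [/= iyk]]]; first by exists (i y).
  by rewrite -iyk.
apply: bigcupT_measurable => k; apply: measurableI => //.
rewrite -[X in measurable X]setTI; exact: measurable_fun_index.
Qed.

(** The image is the mixture over [nu] of the Dirac masses at [u y]. *)
Lemma image_measure_ex d1 d2 (R : realType) (Y : measurableType d1)
    (Z : measurableType d2) (nu : {measure set Y -> \bar R}) (u : Y -> Z) :
  measurable_fun setT u ->
  exists m : {measure set Z -> \bar R},
    forall f : Z -> \bar R, measurable_fun setT f -> (forall z, 0 <= f z)%E ->
      (\int[m]_z f z = \int[nu]_y f (u y))%E.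
Proof.
move=> mu.
pose k y : {measure set Z -> \bar R} := (\d_(u y))%R.
have mk A : measurable A -> measurable_fun setT (k ^~ A).
  move=> mA; apply/measurable_EFinP; apply: measurableT_comp mu.
  exact: measurable_indic.
have [m [_ mE]] := mixture_ex nu mk; exists m => f mf f0; rewrite mE//.
by apply: eq_integral => y _; rewrite integral_dirac// diracT mul1e.
Qed.

(** * Powers and p-norms of nonnegative functions *)

Lemma LnormE_ge0 d (R : realType) (Y : measurableType d)
    (m : {measure set Y -> \bar R}) (p : R) (f : Y -> R) : (forall y, 0 <= f y) ->
  ('N[m]_p%:E[EFin \o f] = (\int[m]_y (f y `^ p)%:E) `^ p^-1)%E.
Proof.
move=> f0; rewrite unlock; congr (_ `^ _)%E; apply: eq_integral => y _ /=.
by rewrite ger0_norm.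
Qed.

Lemma le_poweR (R : realType) (x y : \bar R) (r : R) : 0 <= r ->
  (0 <= x -> x <= y -> x `^ r <= y `^ r)%E.
Proof.
move=> r0 x0 xy; apply: gt0_ler_poweR => //.
- by rewrite in_itv/= x0 leey.
- by rewrite in_itv/= (le_trans x0 xy) leey.
Qed.

Lemma le_Lnorm d (R : realType) (Y : measurableType d)
    (m : {measure set Y -> \bar R}) (p : R) (f g : Y -> R) : 0 <= p ->
  measurable_fun setT f -> measurable_fun setT g ->
  (forall y, 0 <= f y) -> (forall y, f y <= g y) ->
  ('N[m]_p%:E[EFin \o f] <= 'N[m]_p%:E[EFin \o g])%E.
Proof.
move=> p0 mf mg f0 fg.
have g0 y : 0 <= g y by exact: le_trans (fg y).
have mp h : measurable_fun setT h -> measurable_fun setT (fun y : Y => (h y `^ p)%:E).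
  move=> mh; apply/measurable_EFinP.
  exact: (measurableT_comp (measurable_powR p)).
rewrite !LnormE_ge0//; apply: le_poweR; first by rewrite invr_ge0.
  by apply: integral_ge0 => y _; rewrite lee_fin powR_ge0.
have mfp := mp _ mf; have mgp := mp _ mg.
apply: ge0_le_integral => // y _; first by rewrite lee_fin powR_ge0.
by rewrite lee_fin ge0_ler_powR// nnegrE.
Qed.

Lemma Lnorm_le d (R : realType) (Y : measurableType d)
    (m : {measure set Y -> \bar R}) (p C : R) (f : Y -> R) : 0 < p -> 0 <= C ->
  (forall y, 0 <= f y) ->
  (\int[m]_y (f y `^ p)%:E <= (C `^ p)%:E ->
    'N[m]_p%:E[EFin \o f] <= C%:E)%E.
Proof.
move=> p0 C0 f0 fC; rewrite LnormE_ge0//.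
have -> : C%:E = ((C `^ p)%:E `^ p^-1)%E.
  by rewrite poweR_EFin -powRrM divff ?gt_eqF// powRr1.
apply: le_poweR fC; first by rewrite invr_ge0 ltW.
by apply: integral_ge0 => y _; rewrite lee_fin powR_ge0.
Qed.

Lemma sum_index_probability d (R : realType) (Y : measurableType d)
    (q : probability Y R) (i : Y -> nat) :
  (forall n, measurable (i @^-1` [set n])) ->
  (\sum_(n <oo) q (i @^-1` [set n]) = 1)%E.
Proof.
move=> mi; transitivity (\int[q]_y cst 1%E y)%E; last first.
  by rewrite integral_cst// mul1e; exact: probability_setT.
rewrite (@integral_index _ _ _ q i (cst 1%E) mi)//.
by apply: eq_eseriesr => n _; rewrite mul1e.
Qed.

(** * Couplings and transport costs *)

Section coupling_theory.
Context d (R : realType) (T : borelMetricType d R).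
Local Open Scope ereal_scope.

Lemma integral_coupling_fst (m1 m2 : probability T R)
    (Pi : probability (T * T)%type R) (f : T -> \bar R) :
  coupling m1 m2 Pi -> measurable_fun setT f -> (forall x, 0 <= f x) ->
  \int[Pi]_z f z.1 = \int[m1]_x f x.
Proof.
move=> cPi mf f0.
have := ge0_integral_pushforward (@measurable_fst _ _ T T) Pi measurableT mf.
rewrite preimage_setT => <-; last by move=> x _.
by apply: eq_measure_integral => A mA _; have [e1 e2] := cPi A mA; rewrite -?e1 -?e2.
Qed.

Lemma integral_coupling_snd (m1 m2 : probability T R)
    (Pi : probability (T * T)%type R) (f : T -> \bar R) :
  coupling m1 m2 Pi -> measurable_fun setT f -> (forall x, 0 <= f x) ->
  \int[Pi]_z f z.2 = \int[m2]_x f x.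
Proof.
move=> cPi mf f0.
have := ge0_integral_pushforward (@measurable_snd _ _ T T) Pi measurableT mf.
rewrite preimage_setT => <-; last by move=> x _.
by apply: eq_measure_integral => A mA _; have [e1 e2] := cPi A mA; rewrite -?e1 -?e2.
Qed.

(** Written as a p-norm, so that Minkowski's inequality applies to it. *)
Definition transport_cost (p : R) (Pi : {measure set (T * T) -> \bar R}) : \bar R :=
  'N[Pi]_p%:E[EFin \o (fun z => mdist z.1 z.2)].

Lemma wassersteinE (p : R) (m1 m2 : set T -> \bar R) :
  wasserstein p m1 m2 = ereal_inf [set transport_cost p Pi | Pi in coupling m1 m2].
Proof.
rewrite /wasserstein; congr ereal_inf; apply: eq_imagel => Pi _.
by rewrite /transport_cost LnormE_ge0// => z; exact: mdist_ge0.
Qed.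

(** * Gluing a coupling of [mu] and [pi] with a matrix [gam] that couples the cell masses of [mu]
    and [m] *)

Section gluing.
Variables (p : R) (m mu pi : probability T R) (Pi : probability (T * T)%type R).
Variables (i : T -> nat) (gam E : nat -> nat -> R) (C : R).
Hypotheses (sT : separable_space T) (p1 : (1 <= p)%R).
Hypothesis cPi : coupling mu pi Pi.
Hypothesis mi : forall n, measurable (i @^-1` [set n]).
Hypothesis gam0 : forall k l, (0 <= gam k l)%R.
Hypothesis gam_row : forall k,
  \sum_(l <oo) (gam k l)%:E = mu (i @^-1` [set k]).
Hypothesis gam_col : forall l,
  \sum_(k <oo) (gam k l)%:E = m (i @^-1` [set l]).
Hypothesis dE : forall x y, (mdist x y `^ p <= E (i x) (i y))%R.
Hypothesis E0 : forall k l, (0 <= E k l)%R.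
Hypothesis C0 : (0 <= C)%R.
Hypothesis gamE : \sum_(k <oo) \sum_(l <oo) (gam k l * E k l)%:E <= (C `^ p)%:E.

Let a k := fine (mu (i @^-1` [set k])).
Let b l := fine (m (i @^-1` [set l])).
Let aE k : (a k)%:E = mu (i @^-1` [set k]).
Proof. by rewrite /a fineK// fin_num_measure. Qed.
Let bE l : (b l)%:E = m (i @^-1` [set l]).
Proof. by rewrite /b fineK// fin_num_measure. Qed.
Let a0 k : (0 <= a k)%R. Proof. exact: fine_ge0. Qed.
Let b0 l : (0 <= b l)%R. Proof. exact: fine_ge0. Qed.

Let gam_lea k l : (gam k l <= a k)%R.
Proof.
rewrite -lee_fin aE -gam_row (@nneseriesD1 _ _ l)//; last by move=> n _; rewrite lee_fin.
by rewrite leeDl//; apply: nneseries_ge0 => n _ _; rewrite lee_fin.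
Qed.

Let gam_leb k l : (gam k l <= b l)%R.
Proof.
rewrite -lee_fin bE -gam_col (@nneseriesD1 _ _ k)//; last by move=> n _; rewrite lee_fin.
by rewrite leeDl//; apply: nneseries_ge0 => n _ _; rewrite lee_fin.
Qed.

(* The density of gam with respect to the product of the cell weights; its value
   on null cells is irrelevant, and 1 keeps its marginals exact there. *)
Let g k l : R := if (a k * b l == 0)%R then 1%R else (gam k l / (a k * b l))%R.

Let g0 k l : (0 <= g k l)%R.
Proof. by rewrite /g; case: ifPn => // _; rewrite divr_ge0// mulr_ge0. Qed.

Let gab k l : (g k l * (a k * b l) = gam k l)%R.
Proof.
rewrite /g; case: ifPn => [|ab0]; last by rewrite divfK.
move=> /eqP ab0; rewrite ab0 mulr0; apply/esym/eqP; rewrite eq_le gam0 andbT.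
(* One of the two cell masses vanishes, and each of them dominates [gam k l]. *)
have /eqP := ab0; rewrite mulf_eq0 => /orP[|] /eqP <-; [exact: gam_lea|exact: gam_leb].
Qed.

(** Given a first point in cell k, [g k] is a probability density with respect to [m] on the second
    point. For a null cell it is constantly 1, and the sum is the total mass of [m]. *)
Let g_row k : \sum_(l <oo) (g k l)%:E * m (i @^-1` [set l]) = 1.
Proof.
have [ak0|ak0] := eqVneq (a k) 0%R.
  rewrite -(sum_index_probability m mi); apply: eq_eseriesr => l _.
  by rewrite /g ak0 mul0r eqxx mul1e.
transitivity (\sum_(l <oo) ((a k)^-1)%:E * (gam k l)%:E).
  by apply: eq_eseriesr => l _; rewrite -gab -bE -!EFinM mulrCA mulKf.
rewrite nneseriesZl ?gam_row -?aE -?EFinM ?mulVf// => l _.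
by rewrite lee_fin.
Qed.

Let g_col l : \sum_(k <oo) (g k l)%:E * mu (i @^-1` [set k]) = 1.
Proof.
have [bl0|bl0] := eqVneq (b l) 0%R.
  rewrite -(sum_index_probability mu mi); apply: eq_eseriesr => k _.
  by rewrite /g bl0 mulr0 eqxx mul1e.
transitivity (\sum_(k <oo) ((b l)^-1)%:E * (gam k l)%:E).
  apply: eq_eseriesr => k _; rewrite -gab -aE -!EFinM.
  by rewrite (mulrC (a k)) mulrCA mulKf.
rewrite nneseriesZl ?gam_col -?bE -?EFinM ?mulVf// => k _.
by rewrite lee_fin.
Qed.

Let dens (z : (T * T) * T) : R := g (i z.1.1) (i z.2).

Let mi1 n : measurable ((fun z : (T * T) * T => i z.1.1) @^-1` [set n]).
Proof.
have mf : measurable_fun setT (fun z : (T * T) * T => z.1.1).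
  exact: (measurableT_comp measurable_fst).
by rewrite -[X in measurable X]setTI; exact: (mf measurableT _ (mi n)).
Qed.

Let mi2 n : measurable ((fun z : (T * T) * T => i z.2) @^-1` [set n]).
Proof.
by rewrite -[X in measurable X]setTI; exact: (@measurable_snd _ _ _ _ measurableT _ (mi n)).
Qed.

Let mdens : measurable_fun setT dens.
Proof. exact: measurable_fun_index2 mi1 mi2. Qed.

(** Integrating out the third point leaves [Pi], since each row of [g] has total mass 1 under
    [m]. *)
Let int_snd (f : T * T -> \bar R) : measurable_fun setT f ->
  (forall z, 0 <= f z) ->
  \int[Pi \x m]_z ((dens z)%:E * f z.1) = \int[Pi]_z f z.
Proof.
move=> mf f0; rewrite fubini_tonelli1//=; last 2 first.
- apply: emeasurable_funM; first exact/measurable_EFinP.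
  exact: (measurableT_comp mf measurable_fst).
- by move=> z; rewrite mule_ge0// lee_fin g0.
apply: eq_integral => z _; rewrite /fubini_F/=.
rewrite ge0_integralZr//=.
- rewrite (@integral_index _ _ _ m i (fun l => (g (i z.1) l)%:E))//.
    by rewrite g_row mul1e.
  by move=> n; rewrite lee_fin g0.
- apply/measurable_EFinP; exact: (@measurable_fun_index _ _ _ _ i (g (i z.1)) mi).
- by move=> x _; rewrite lee_fin g0.
Qed.

(** Integrating out the pair leaves [m]: the density sees only the first point of the pair, whose
    law is [mu], and each column of [g] has total mass 1 under [mu]. *)
Let int_fst (f : T -> \bar R) : measurable_fun setT f ->
  (forall x, 0 <= f x) ->
  \int[Pi \x m]_z ((dens z)%:E * f z.2) = \int[m]_x f x.
Proof.
move=> mf f0; rewrite fubini_tonelli2//=; last 2 first.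
- apply: emeasurable_funM; first exact/measurable_EFinP.
  exact: (measurableT_comp mf measurable_snd).
- by move=> z; rewrite mule_ge0// lee_fin g0.
apply: eq_integral => x _; rewrite /fubini_G/=.
have mgx : measurable_fun setT (fun y => (g (i y) (i x))%:E).
  apply/measurable_EFinP.
  exact: (@measurable_fun_index _ _ _ _ i (g^~ (i x)) mi).
rewrite ge0_integralZr//=.
- rewrite /dens/= (integral_coupling_fst cPi mgx); last first.
    by move=> y; rewrite lee_fin g0.
  rewrite (@integral_index _ _ _ mu i (fun k => (g k (i x))%:E))//.
    by rewrite g_col mul1e.
  by move=> n; rewrite lee_fin g0.
- exact: (measurableT_comp mgx measurable_fst).
- by move=> z _; rewrite lee_fin g0.
Qed.

(** Under the density [dens], the cells of the first and the third point have joint law [gam]. *)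
Let int_cells (f : nat -> nat -> R) : (forall k l, (0 <= f k l)%R) ->
  \int[Pi \x m]_z ((dens z)%:E * (f (i z.1.1) (i z.2))%:E) =
  \sum_(k <oo) \sum_(l <oo) (gam k l * f k l)%:E.
Proof.
move=> f0.
pose h k l := (g k l * f k l)%:E.
have h0 k l : 0 <= h k l by rewrite lee_fin mulr_ge0.
transitivity (\int[Pi \x m]_z h (i z.1.1) (i z.2)).
  by apply: eq_integral => z _; rewrite -EFinM.
rewrite fubini_tonelli1//=; last exact: measurable_fun_index2 mi1 mi2.
pose H k := \sum_(l <oo) h k l * m (i @^-1` [set l]).
have H0 k : 0 <= H k by apply: nneseries_ge0 => l _ _; rewrite mule_ge0.
transitivity (\int[Pi]_z H (i z.1)).
  by apply: eq_integral => z _; rewrite /fubini_F/= integral_index.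
rewrite (integral_coupling_fst cPi (f := H \o i)) => [|//|]; last first.
- by move=> x /=.
- exact: measurable_fun_index.
rewrite integral_index//; apply: eq_eseriesr => k _.
rewrite muleC [X in X * _](_ : _ = (a k)%:E); last by rewrite aE.
rewrite /H -nneseriesZl; last by move=> l _; rewrite mule_ge0.
apply: eq_eseriesr => l _.
by rewrite -bE -!EFinM -(gab k l); congr EFin; ring.
Qed.

(** A law on triples ((x, z), y) is built with density [dens] with respect to the product of [Pi]
    and [m]: (x, z) has law [Pi], y has law [m], and the cells of x and y have law [gam]. The pair
    (y, z) is the new coupling. The triangle inequality through x and Minkowski's inequality bound
    its cost. *)
Lemma gluing : exists2 Pi' : probability (T * T)%type R,
  coupling m pi Pi' & transport_cost p Pi' <= transport_cost p Pi + C%:E.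
Proof.
have [M ME] := density_ex (Pi \x m) mdens (fun z => g0 _ _).
have mproj : measurable_fun setT (fun z : (T * T) * T => (z.2, z.1.2)).
  apply: measurable_fun_pair; first exact: measurable_snd.
  exact: (measurableT_comp measurable_snd).
have [M' M'E] := image_measure_ex M mproj.
have M'_fst A : measurable A -> M' (fst @^-1` A) = m A.
  move=> mA; have mA1 : measurable (@fst T T @^-1` A).
    rewrite -[X in measurable X]setTI; exact: measurable_fst.
  have := M'E (fun z => (\1_(fst @^-1` A) z)%:E).
  rewrite integral_indic// setIT => ->//; last first.
    by apply/measurable_EFinP; exact: measurable_indic.
  have mI : measurable_fun setT (fun x : T => (\1_A x)%:E : \bar R).
    by apply/measurable_EFinP; exact: measurable_indic.
  transitivity (\int[M]_z (\1_A z.2)%:E).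
    by apply: eq_integral => z _; rewrite !indicE.
  rewrite (ME (fun z => (\1_A z.2)%:E))//; last first.
    exact: (measurableT_comp mI measurable_snd).
  by rewrite (int_fst mI)// integral_indic// setIT.
have M'_snd A : measurable A -> M' (snd @^-1` A) = pi A.
  move=> mA; have mA2 : measurable (@snd T T @^-1` A).
    rewrite -[X in measurable X]setTI; exact: measurable_snd.
  have := M'E (fun z => (\1_(snd @^-1` A) z)%:E).
  rewrite integral_indic// setIT => ->//; last first.
    by apply/measurable_EFinP; exact: measurable_indic.
  have mI : measurable_fun setT (fun x : T * T => (\1_(snd @^-1` A) x)%:E : \bar R).
    by apply/measurable_EFinP; exact: measurable_indic.
  transitivity (\int[M]_z (\1_(snd @^-1` A) z.1)%:E).
    by apply: eq_integral => z _; rewrite !indicE.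
  rewrite (ME (fun z => (\1_(snd @^-1` A) z.1)%:E))//; last first.
    exact: (measurableT_comp mI measurable_fst).
  rewrite (int_snd mI)// integral_indic//; have [_ <-] := cPi mA.
  by congr (Pi _); exact: setIT.
have M'1 : M' setT = 1.
  rewrite -(preimage_setT fst) M'_fst//; exact: probability_setT.
have [Pi' Pi'E] := probability_ex M'1.
exists Pi'; first by move=> A mA; rewrite Pi'E M'_fst// M'_snd.
have p0 : (0 < p)%R by exact: lt_le_trans p1.
(* The three sides of the triangle: [f1] joins x and y and is controlled by [gam], [f2] joins x and
   z and gives the cost of [Pi], [f3] joins y and z and gives the cost of [Pi']. *)
pose f1 (z : (T * T) * T) : R := mdist z.1.1 z.2.
pose f2 (z : (T * T) * T) : R := mdist z.1.1 z.1.2.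
pose f3 (z : (T * T) * T) : R := mdist z.2 z.1.2.
have m11 : measurable_fun setT (fun z : (T * T) * T => z.1.1).
  exact: (measurableT_comp measurable_fst).
have m12 : measurable_fun setT (fun z : (T * T) * T => z.1.2).
  exact: (measurableT_comp measurable_snd).
have mf1 : measurable_fun setT f1 by apply: measurable_fun_mdist.
have mf2 : measurable_fun setT f2 by apply: measurable_fun_mdist.
have mf3 : measurable_fun setT f3 by apply: measurable_fun_mdist.
have mdp : measurable_fun setT (fun z : T * T => (mdist z.1 z.2 `^ p)%:E : \bar R).
  apply/measurable_EFinP; apply: (measurableT_comp (measurable_powR p)).
  exact: measurable_fun_mdist.
have f1C : 'N[M]_p%:E[EFin \o f1] <= C%:E.
  apply: Lnorm_le => //; first by move=> z; exact: mdist_ge0.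
  apply: le_trans gamE; rewrite -int_cells// -ME//; last 2 first.
  - apply/measurable_EFinP; exact: measurable_fun_index2 mi1 mi2.
  - by move=> z; rewrite lee_fin.
  apply: ge0_le_integral => //.
  - by move=> z _; rewrite lee_fin powR_ge0.
  - apply/measurable_EFinP; exact: (measurableT_comp (measurable_powR p)).
  - apply/measurable_EFinP; exact: measurable_fun_index2 mi1 mi2.
  - by move=> z _; rewrite lee_fin dE.
have f2E : 'N[M]_p%:E[EFin \o f2] = transport_cost p Pi.
  rewrite /transport_cost !LnormE_ge0//; try by move=> z; exact: mdist_ge0.
  congr (_ `^ _); rewrite -int_snd// => [|z]; last by rewrite lee_fin powR_ge0.
  rewrite -ME// => [|z]; last by rewrite lee_fin powR_ge0.
  exact: (measurableT_comp mdp measurable_fst).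
have f3E : transport_cost p Pi' = 'N[M]_p%:E[EFin \o f3].
  rewrite /transport_cost !LnormE_ge0//; try by move=> z; exact: mdist_ge0.
  congr (_ `^ _); have := M'E _ mdp; rewrite /f3/= => <- => [|z].
    by apply: eq_measure_integral => A _ _; rewrite -Pi'E.
  by rewrite lee_fin powR_ge0.
rewrite f3E addeC -f2E.
apply: le_trans (leeD2r _ f1C); apply: le_trans (minkowski_EFin M mf1 mf2 p1).
apply: le_Lnorm => //; [exact: ltW|exact: measurable_funD|..].
- by move=> z; exact: mdist_ge0.
- by move=> z /=; rewrite /f1 (metric_sym z.1.1); exact: metric_triangle.
Qed.

End gluing.
End coupling_theory.

(** * Coupling two probability sequences with a common lower bound *)

Section coupling_matrix.
Local Open Scope ereal_scope.
Context (R : realType).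
Implicit Types u v w : nat -> R.

Let delta u k : (forall l, (0 <= u l)%R) ->
  \sum_(l <oo) (if k == l then u l else 0%R)%:E = (u k)%:E.
Proof.
move=> u0; rewrite (@nneseriesD1 _ _ k)//; last first.
  by move=> l _; case: ifP; rewrite lee_fin.
rewrite eqxx eseries0 ?adde0// => l _ /=.
by rewrite eq_sym => /negbTE ->.
Qed.

Variables a b q : nat -> R.
Hypothesis q0 : forall k, (0 <= q k)%R.
Hypothesis qa : forall k, (q k <= a k)%R.
Hypothesis qb : forall k, (q k <= b k)%R.
Hypothesis a1 : \sum_(k <oo) (a k)%:E = 1.
Hypothesis b1 : \sum_(k <oo) (b k)%:E = 1.

Let al k : R := (a k - q k)%R.
Let be k : R := (b k - q k)%R.
Let al0 k : (0 <= al k)%R. Proof. by rewrite subr_ge0. Qed.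
Let be0 k : (0 <= be k)%R. Proof. by rewrite subr_ge0. Qed.

Let sum_ge0 u : (forall k, (0 <= u k)%R) -> 0 <= \sum_(k <oo) (u k)%:E.
Proof. by move=> u0; apply: nneseries_ge0 => k _ _; rewrite lee_fin. Qed.

Let sum_q : \sum_(k <oo) (q k)%:E <= 1.
Proof.
by rewrite -a1; apply: lee_nneseries => k _; rewrite lee_fin.
Qed.

Let eps : R := (1 - fine (\sum_(k <oo) (q k)%:E))%R.

Let qE : (fine (\sum_(k <oo) (q k)%:E))%:E = \sum_(k <oo) (q k)%:E.
Proof. by rewrite fineK// ge0_fin_numE ?sum_ge0// (le_lt_trans sum_q)// ltry. Qed.

Let sum_sub c : (forall k, (q k <= c k)%R) -> \sum_(k <oo) (c k)%:E = 1 ->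
  \sum_(k <oo) (c k - q k)%:E = eps%:E.
Proof.
move=> qc c1; rewrite /eps EFinB -c1 qE.
have -> : \sum_(k <oo) (c k)%:E =
    \sum_(k <oo) (c k - q k)%:E + \sum_(k <oo) (q k)%:E.
  rewrite -nneseriesD; [|by move=> k _ _; rewrite lee_fin ?subr_ge0..].
  by apply: eq_eseriesr => k _; rewrite -EFinD subrK.
by rewrite addeK// -qE.
Qed.

Let sum_al : \sum_(k <oo) (al k)%:E = eps%:E. Proof. exact: sum_sub. Qed.
Let sum_be : \sum_(k <oo) (be k)%:E = eps%:E. Proof. exact: sum_sub. Qed.

Let eps0 : (0 <= eps)%R.
Proof. by rewrite -lee_fin -sum_al; exact: sum_ge0. Qed.

(** When [eps] is 0 the quotient [eps / eps] is 0 by convention, but then every [c k] is 0 as well.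
    No case distinction on [eps] is needed afterwards. *)
Let absorb c : (forall k, (0 <= c k)%R) -> \sum_(k <oo) (c k)%:E = eps%:E ->
  forall k, (c k * (eps / eps) = c k)%R.
Proof.
move=> c0 ce k; have [e0|e0] := eqVneq eps 0%R; last by rewrite divff// mulr1.
suff -> : c k = 0%R by rewrite mul0r.
apply/eqP; rewrite eq_le c0 andbT -lee_fin -e0 -ce.
rewrite (@nneseriesD1 _ _ k)//; last by move=> n _; rewrite lee_fin.
by rewrite leeDl//; apply: nneseries_ge0 => n _ _; rewrite lee_fin.
Qed.

(** The common part [q] stays on the diagonal; the residues [al] and [be], both of total mass [eps],
    are coupled independently. *)
Let gam k l : R := ((if k == l then q l else 0) + al k * be l / eps)%R.

(** In the cost estimate the diagonal part pays at most [c0], since [q] has total mass at most 1.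
    The product part has marginals [al] and [be], so the bound [c1 * (w k + w l)] integrates to [c1]
    times the sum of their [w]-moments. *)
Lemma coupling_matrix : exists gam : nat -> nat -> R,
  [/\ forall k l, (0 <= gam k l)%R,
      forall k, \sum_(l <oo) (gam k l)%:E = (a k)%:E,
      forall l, \sum_(k <oo) (gam k l)%:E = (b l)%:E
    & forall (E : nat -> nat -> R) (w : nat -> R) (c0 c1 : R),
      (forall k l, 0 <= E k l)%R -> (forall k, 0 <= w k)%R ->
      (0 <= c0)%R -> (0 <= c1)%R ->
      (forall k, E k k <= c0)%R -> (forall k l, E k l <= c1 * (w k + w l))%R ->
      \sum_(k <oo) \sum_(l <oo) (gam k l * E k l)%:E <=
      c0%:E + c1%:E * (\sum_(k <oo) ((a k - q k) * w k)%:E +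
                       \sum_(k <oo) ((b k - q k) * w k)%:E)].
Proof.
have gam1 k l : (0 <= (if k == l then q l else 0))%R by case: ifP.
have gam2 k l : (0 <= al k * be l / eps)%R by rewrite divr_ge0 ?mulr_ge0.
have scal x u : (forall k, (0 <= u k)%R) -> \sum_(l <oo) (x * u l)%:E =
    x%:E * \sum_(l <oo) (u l)%:E.
  move=> u0; under eq_eseriesr do rewrite EFinM.
  by rewrite nneseriesZl// => l _; rewrite lee_fin.
have row k : \sum_(l <oo) (al k * be l / eps)%:E = (al k)%:E.
  under eq_eseriesr do rewrite mulrAC.
  by rewrite scal// sum_be -EFinM -mulrA (mulrC _ eps) absorb.
have col l : \sum_(k <oo) (al k * be l / eps)%:E = (be l)%:E.
  under eq_eseriesr do rewrite -mulrA mulrC.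
  by rewrite scal// sum_al -EFinM -mulrA (mulrC _ eps) absorb.
exists gam; split.
- by move=> k l; rewrite /gam addr_ge0.
- move=> k; rewrite /gam; under eq_eseriesr do rewrite EFinD.
  rewrite nneseriesD; [|by move=> l _ _; rewrite lee_fin..].
  by rewrite delta// row -EFinD /al addrC subrK.
- move=> l; rewrite /gam; under eq_eseriesr do rewrite EFinD.
  rewrite nneseriesD; [|by move=> k _ _; rewrite lee_fin..].
  have -> : \sum_(k <oo) (if k == l then q l else 0%R)%:E = (q l)%:E.
    by rewrite -(delta l q0); apply: eq_eseriesr => k _; case: eqVneq => [->|].
  by rewrite col -EFinD /be addrC subrK.
move=> E w c0 c1 E0 w0 c00 c10 Ec0 Ec1.
pose g k l := (al k * be l / eps)%R.
apply: (@le_trans _ _ (\sum_(k <oo) \sum_(l <oo)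
    ((if k == l then c0 * q l else 0)%:E +
     c1%:E * ((g k l * w k)%:E + (g k l * w l)%:E)))).
  apply: lee_nneseries => [k _ _|k _].
    by apply: nneseries_ge0 => l _ _; rewrite lee_fin mulr_ge0// addr_ge0.
  apply: lee_nneseries => [l _ _|l _]; first by rewrite lee_fin mulr_ge0// addr_ge0.
  rewrite -(EFinD (g k l * w k)) -EFinM -EFinD lee_fin /gam mulrDl lerD//.
    by case: eqVneq => [->|_]; [rewrite mulrC ler_wpM2r|rewrite mul0r].
  by rewrite -mulrDr mulrCA ler_wpM2l.
have sD (u v : nat -> \bar R) : (forall k, 0 <= u k) -> (forall k, 0 <= v k) ->
    \sum_(k <oo) (u k + v k) = \sum_(k <oo) u k + \sum_(k <oo) v k.
  by move=> u0 v0; rewrite nneseriesD.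
have gw0 k l n : 0 <= (g k l * w n)%:E by rewrite lee_fin mulr_ge0// gam2.
have cq0 k l : 0 <= (if k == l then c0 * q l else 0)%:E.
  by rewrite lee_fin; case: ifP => // _; rewrite mulr_ge0.
have -> : \sum_(k <oo) \sum_(l <oo)
    ((if k == l then c0 * q l else 0)%:E +
     c1%:E * ((g k l * w k)%:E + (g k l * w l)%:E)) =
  \sum_(k <oo) ((c0 * q k)%:E + c1%:E * ((al k * w k)%:E +
    \sum_(l <oo) (g k l * w l)%:E)).
  apply: eq_eseriesr => k _; rewrite sD//; last first.
    by move=> l; apply: mule_ge0; [rewrite lee_fin|exact: adde_ge0].
  rewrite delta; last by move=> l; rewrite mulr_ge0.
  congr (_ + _); rewrite nneseriesZl; last by move=> l _; rewrite adde_ge0.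
  congr (_ * _); rewrite sD//; congr (_ + _).
  under eq_eseriesr do rewrite mulrC.
  by rewrite scal ?row -?EFinM 1?mulrC// => l; exact: gam2.
have gws0 k : 0 <= \sum_(l <oo) (g k l * w l)%:E by exact: nneseries_ge0.
have alw0 k : 0 <= (al k * w k)%:E by rewrite lee_fin mulr_ge0.
rewrite sD; last 2 first.
- by move=> k; rewrite lee_fin mulr_ge0.
- by move=> k; apply: mule_ge0; [rewrite lee_fin|exact: adde_ge0].
rewrite leeD//.
  rewrite scal// -[leRHS]mule1; exact: lee_wpmul2l.
rewrite nneseriesZl; last by move=> k _; rewrite adde_ge0.
rewrite lee_wpmul2l// sD// leeD2l//.
(* The term in [w l] is summed over [k] first, where the column sums of the product part give
   [be l]. *)
rewrite nneseries_interchange// lee_nneseries// => [l _ _|l _].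
  by rewrite nneseries_ge0.
under eq_eseriesr do rewrite mulrC.
by rewrite scal ?col -?EFinM 1?mulrC// => k; exact: gam2.
Qed.

End coupling_matrix.

(** * Measures that share a profile of cell masses *)

Section profile.
Local Open Scope ereal_scope.
Context d (R : realType) (T : borelMetricType d R).
Variables (p e : R) (x0 : T) (a : nat -> T) (i : T -> nat).
Hypotheses (sT : separable_space T) (p1 : (1 <= p)%R) (e0 : (0 < e)%R).
Hypothesis mi : forall n, measurable (i @^-1` [set n]).
Hypothesis ai : forall x, (mdist (a (i x)) x < e)%R.

(** On cell k this dominates the p-th power of the distance to [x0], because the cell lies within
    [e] of [a k]. *)
Definition cell_weight k : R := ((mdist x0 (a k) + e) `^ p)%R.
Local Notation w := cell_weight.

(* These constraints are linear in mu, hence stable under averaging, and two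
   measures that satisfy them are at Wasserstein distance at most 6 e. *)
Definition in_profile (q : nat -> R) (mu : set T -> \bar R) :=
  (forall k, (q k)%:E <= mu (i @^-1` [set k])) /\
  \sum_(k <oo) (w k)%:E * mu (i @^-1` [set k]) <=
    \sum_(k <oo) (q k * w k)%:E + (e `^ p)%:E.

Let p0 : (0 < p)%R. Proof. exact: lt_le_trans p1. Qed.

Let w0 k : (0 <= w k)%R. Proof. exact: powR_ge0. Qed.

(** Both [mu] and [m] exceed [q] by a residue of [w]-moment at most [e ^ p]. Hence [coupling_matrix]
    couples their cell masses so that most mass stays in its cell and the rest is cheap to move;
    [gluing] then replaces [mu] by [m]. *)
Lemma in_profile_coupling (q : nat -> R) (mu m pi : probability T R)
    (Pi : probability (T * T)%type R) :
  (forall k, (0 <= q k)%R) -> \sum_(k <oo) (q k * w k)%:E < +oo ->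
  in_profile q mu -> in_profile q m -> coupling mu pi Pi ->
  exists2 Pi' : probability (T * T)%type R, coupling m pi Pi' &
    transport_cost p Pi' <= transport_cost p Pi + (6 * e)%:E.
Proof.
move=> q0 qoo [qmu wmu] [qm wm] cPi.
pose b (nu : probability T R) k := fine (nu (i @^-1` [set k])).
have bE (nu : probability T R) k : (b nu k)%:E = nu (i @^-1` [set k]).
  by rewrite /b fineK// fin_num_measure.
have qb (nu : probability T R) k :
    (q k)%:E <= nu (i @^-1` [set k]) -> (q k <= b nu k)%R.
  by rewrite -bE lee_fin.
have b1 (nu : probability T R) : \sum_(k <oo) (b nu k)%:E = 1.
  by rewrite -(sum_index_probability nu mi); apply: eq_eseriesr => k _; rewrite bE.
have res (nu : probability T R) : in_profile q nu ->
    \sum_(k <oo) ((b nu k - q k) * w k)%:E <= (e `^ p)%:E.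
  move=> [qnu wnu].
  have qw0 : 0 <= \sum_(k <oo) (q k * w k)%:E.
    by apply: nneseries_ge0 => k _ _; rewrite lee_fin mulr_ge0.
  (* Finiteness allows the [w]-moment of [q] to be cancelled on both sides. *)
  have qwfin : \sum_(k <oo) (q k * w k)%:E \is a fin_num.
    by rewrite ge0_fin_numE.
  rewrite -(leeD2rE _ _ qwfin) addeC [leRHS]addeC.
  apply: le_trans wnu; rewrite -nneseriesD; last 2 first.
  - by move=> k _ _; rewrite lee_fin mulr_ge0.
  - by move=> k _ _; rewrite lee_fin mulr_ge0// subr_ge0 qb.
  apply: lee_nneseries => [k _ _|k _].
    by rewrite -EFinD lee_fin -mulrDl mulr_ge0// subrKC -lee_fin bE.
  by rewrite -EFinD -bE -EFinM lee_fin -mulrDl subrKC mulrC.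
have [gam [gam0 row col gamE]] := coupling_matrix q0 (fun k => qb mu k (qmu k))
  (fun k => qb m k (qm k)) (b1 mu) (b1 m).
(* Two points of one cell are within [2 * e] of each other through the centre; points of different
   cells are compared through [x0]. *)
pose E k l : R := (if k == l then (2 * e) `^ p else
  (mdist x0 (a k) + e + (mdist x0 (a l) + e)) `^ p)%R.
have E0 k l : (0 <= E k l)%R by rewrite /E; case: ifP => _; exact: powR_ge0.
have De k : (e <= mdist x0 (a k) + e)%R by rewrite lerDr mdist_ge0.
have ED k l : (E k l <= (mdist x0 (a k) + e + (mdist x0 (a l) + e)) `^ p)%R.
  rewrite /E; case: ifP => // _; apply: ge0_ler_powR; rewrite ?nnegrE ?(ltW p0)//.
  - by rewrite mulr_ge0// ltW.
  - by rewrite !addr_ge0// ?mdist_ge0 ?ltW.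
  - by rewrite mulr_natl mulr2n lerD.
have Ew k l : (E k l <= 2 `^ p * (w k + w l))%R.
  apply: le_trans (ED k l) _; rewrite /w.
  have := De k; have := De l.
  move: (mdist x0 (a k) + e)%R (mdist x0 (a l) + e)%R => u v ev eu.
  have u0 : (0 <= u)%R by rewrite (le_trans _ eu)// ltW.
  have v0 : (0 <= v)%R by rewrite (le_trans _ ev)// ltW.
  (* With M the maximum of [u] and [v], the p-th power of [u + v] is at most that of 2 M, and M is
     one of the two. *)
  apply: (@le_trans _ _ ((2 * Num.max u v) `^ p)%R).
    apply: ge0_ler_powR; rewrite ?nnegrE ?(ltW p0) ?addr_ge0 ?mulr_ge0 ?le_max ?u0//.
    by rewrite mulr_natl mulr2n lerD// le_max lexx ?orbT.
  rewrite powRM ?le_max ?u0// ler_wpM2l ?powR_ge0//.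
  by have [_|_] := leP u v; [rewrite lerDr|rewrite lerDl]; exact: powR_ge0.
have dE x y : (mdist x y `^ p <= E (i x) (i y))%R.
  have dx z : (mdist x0 z <= mdist x0 (a (i z)) + e)%R.
    by apply: le_trans (metric_triangle _ (a (i z)) _) _; rewrite lerD2l ltW.
  rewrite /E; case: eqVneq => [ixy|_]; apply: ge0_ler_powR;
    rewrite ?nnegrE ?(ltW p0) ?mdist_ge0//.
  - by rewrite mulr_ge0// ltW.
  - apply: le_trans (metric_triangle _ (a (i x)) _) _.
    rewrite mulr_natl mulr2n metric_sym lerD//; first exact: ltW.
    by rewrite ixy ltW.
  - by rewrite !addr_ge0// ?mdist_ge0 ?ltW.
  - apply: le_trans (metric_triangle _ x0 _) _.
    by rewrite metric_sym lerD.
apply: (@gluing _ _ _ p m mu pi Pi i gam E (6 * e)%R) => //.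
- by move=> k; rewrite row bE.
- by move=> l; rewrite col bE.
- by rewrite mulr_ge0// ltW.
apply: le_trans (gamE E w ((2 * e) `^ p)%R (2 `^ p)%R E0 w0 _ _ _ Ew) _ => //.
- exact: powR_ge0.
- by move=> k; rewrite /E eqxx.
apply: (@le_trans _ _ (((2 * e) `^ p)%:E +
    (2 `^ p)%:E * ((e `^ p)%:E + (e `^ p)%:E))).
  rewrite leeD2l// lee_wpmul2l ?lee_fin ?powR_ge0// leeD//; exact: res.
rewrite -(EFinD (e `^ p)) -EFinM -EFinD lee_fin mulrDr -powRM ?(ltW e0)//.
(* Origin of the 6: the diagonal costs one (2e)^p and the two residues one each, and 3 is at most
   3^p because p is at least 1. *)
have -> : (6 * e = 3 * (2 * e))%R by ring.
rewrite [leRHS]powRM ?mulr_ge0 ?(ltW e0)//.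
apply: (@le_trans _ _ (3 * (2 * e) `^ p)%R); first by lra.
by rewrite ler_wpM2r ?powR_ge0// le1r_powR// ler1n.
Qed.

(** A code consists of a list of numerators and a common denominator [c.2.+1]; masses beyond the
    list are 0. Codes form a countable type, so countably many profiles are in play. *)
Definition grid (c : seq nat * nat) k : R := ((nth 0%N c.1 k)%:R / c.2.+1%:R)%R.

Lemma grid_ge0 c k : (0 <= grid c k)%R.
Proof. by rewrite divr_ge0. Qed.

Lemma grid_lty c : \sum_(k <oo) (grid c k * w k)%:E < +oo.
Proof.
rewrite (nneseries_split _ (size c.1)); last by move=> k _; rewrite lee_fin mulr_ge0 ?grid_ge0.
rewrite eseries0 ?adde0; last first.
  by move=> k ck _; rewrite /grid nth_default// !mul0r.
by rewrite sumEFin ltry.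
Qed.

(** The masses of the first [n] cells are rounded down to multiples of 1/(N+1) and the others
    dropped. The dropped tail and the rounding error each use half of the allowed residue
    [e ^ p]. *)
Lemma grid_in_profile (mu : probability T R) :
  \sum_(k <oo) (w k)%:E * mu (i @^-1` [set k]) < +oo ->
  exists c, in_profile (grid c) mu.
Proof.
move=> wmu; pose b k := fine (mu (i @^-1` [set k])).
have bE k : (b k)%:E = mu (i @^-1` [set k]).
  by rewrite /b fineK// fin_num_measure.
have b0 k : (0 <= b k)%R by exact: fine_ge0.
pose u k := (w k)%:E * mu (i @^-1` [set k]).
have uE k : u k = (b k * w k)%:E by rewrite /u -bE -EFinM mulrC.
have u0 k : 0 <= u k by rewrite uE lee_fin mulr_ge0.
have ep0 : (0 < e `^ p / 2)%R by rewrite divr_gt0// powR_gt0.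
have [n tail] : exists n, \sum_(n <= k <oo) u k <= (e `^ p / 2)%:E.
  have /(_ _ (open_ereal_lt' _)) := nneseries_tail_cvg wmu (fun k _ => u0 k).
  move=> /(_ (e `^ p / 2)%:E); rewrite lte_fin => /(_ ep0)[n _ nP].
  by exists n; rewrite ltW//; exact: (nP n (leqnn n)).
pose W := (\sum_(k < n) w k)%R.
have W0 : (0 <= W)%R by exact: sumr_ge0.
(* Rounding loses at most 1/(N+1) on each of the [n] cells, hence at most W/(N+1) in [w]-moment. *)
have [N WN] : exists N, (W / N.+1%:R <= e `^ p / 2)%R.
  exists (Num.truncn (W / (e `^ p / 2))).
  rewrite ler_pdivrMr// mulrC -ler_pdivrMr// ltW//.
  by have /andP[] := truncn_itv (divr_ge0 W0 (ltW ep0)).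
pose q k : R := if (k < n)%N then ((Num.truncn (b k * N.+1%:R))%:R / N.+1%:R)%R else 0%R.
exists (mkseq (fun k => Num.truncn (b k * N.+1%:R)) n, N).
have gq k : grid (mkseq (fun k => Num.truncn (b k * N.+1%:R)) n, N) k = q k.
  rewrite /grid /q/=; case: ltnP => kn; first by rewrite nth_mkseq.
  by rewrite nth_default ?size_mkseq// mul0r.
split.
  move=> k; rewrite gq -bE lee_fin /q; case: ifP => // _.
  by rewrite ler_pdivrMr// truncn_le// mulr_ge0.
under [X in X + _]eq_eseriesr do rewrite gq.
rewrite (nneseries_split _ n); last by move=> k _; exact: u0.
apply: (@le_trans _ _ (\sum_(0 <= k < n) (q k * w k)%:E +
    (W / N.+1%:R)%:E + (e `^ p / 2)%:E)).
  rewrite leeD// !big_mkord.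
  under eq_bigr do rewrite -/(u _) uE.
  rewrite !sumEFin -EFinD lee_fin mulr_suml -big_split ler_sum//= => k _.
  rewrite [leRHS](_ : _ = (q k + N.+1%:R^-1) * w k)%R; last by ring.
  rewrite ler_wpM2r// /q (ltn_ord k : (k < n)%N)/=.
  rewrite -[X in (_ <= _ + X)%R]div1r -mulrDl ler_pdivlMr// natr1.
  by rewrite ltW//; have /andP[] := truncn_itv (mulr_ge0 (b0 k) (ler0n _ N.+1)).
rewrite -addeA leeD//; last first.
  by rewrite -EFinD lee_fin; move: WN; move: (W / _)%R => y; lra.
apply: (@nneseries_lim_ge R (fun k => (q k * w k)%:E) xpredT 0) => k _.
by rewrite lee_fin mulr_ge0// /q; case: ifP => // _; rewrite divr_ge0.
Qed.

(** The measure [m] is the conditional mean of [k v] given [D]; the constraints of the profile are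
    linear and pass through the integral. *)
Lemma in_profile_average dO (Omega : measurableType dO) (Q : probability Omega R)
    (k : Omega -> probability T R) (D : set Omega) (v0 : Omega) (q : nat -> R) :
  (forall n, (0 <= q n)%R) -> \sum_(n <oo) (q n * w n)%:E < +oo ->
  (forall A, measurable A -> measurable_fun setT (fun v => k v A)) ->
  measurable D -> D v0 -> (forall v, D v -> in_profile q (k v)) ->
  exists2 m : probability T R,
    forall A, measurable A -> Q D * m A = \int[Q]_(v in D) k v A & in_profile q m.
Proof.
move=> q0 qoo mk mD Dv0 kq.
(* On a null piece the averaging identity is trivial, and the member [k v0] already satisfies the
   profile. *)
have [QD0|QD0] := eqVneq (Q D) 0.
  exists (k v0); last exact: kq.
  move=> A mA; rewrite QD0 mul0e; apply/esym/eqP; rewrite eq_le integral_ge0// andbT.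
  apply: (@le_trans _ _ (\int[Q]_(v in D) cst 1 v)).
    apply: ge0_le_integral => //; first exact: measurable_funTS (mk _ mA).
    by move=> v _; exact: probability_le1.
  by rewrite integral_cst// mul1e [leLHS](_ : _ = 0).
pose c := fine (Q D).
have cE : c%:E = Q D by rewrite /c fineK// fin_num_measure.
have c0 : (0 < c)%R by rewrite -lte_fin cE lt0e QD0 measure_ge0.
have g0 v : (0 <= \1_D v / c :> R)%R by rewrite divr_ge0// ltW.
pose h v : {measure set T -> \bar R} := mscale (NngNum (g0 v)) (k v).
have mh A : measurable A -> measurable_fun setT (h ^~ A).
  move=> mA; apply: emeasurable_funM; last exact: mk.
  by apply/measurable_EFinP; apply: measurable_funM => //; exact: measurable_indic.
have [M [ME _]] := mixture_ex Q mh.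
have cM A : measurable A -> Q D * M A = \int[Q]_(v in D) k v A.
  move=> mA; rewrite ME -cE -ge0_integralZl//; last 2 first.
  - exact: mh.
  - by rewrite lee_fin ltW.
  rewrite [RHS]integral_mkcond; apply: eq_integral => v _.
  rewrite /h /mscale/= muleA -EFinM mulrCA divff ?gt_eqF// mulr1 epatch_indic.
  by rewrite muleC.
have M1 : M setT = 1.
  have := cM setT measurableT.
  under eq_integral do rewrite probability_setT.
  rewrite integral_cst// mul1e -cE => QM.
  have cM1 : c%:E * M setT = c%:E by rewrite [RHS]cE.
  have : (c^-1)%:E * (c%:E * M setT) = 1.
    by rewrite cM1 -EFinM mulVf ?gt_eqF.
  by rewrite muleA -EFinM mulVf ?gt_eqF// mul1e.
have [m mE] := probability_ex M1.
have Qm A : measurable A -> Q D * m A = \int[Q]_(v in D) k v A.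
  by move=> mA; rewrite mE cM.
exists m => //.
(* Each constraint is multiplied by [Q D], positive and finite, so that it compares two integrals
   over [D]; the integrands are compared pointwise. *)
have kcst (x : \bar R) : Q D * x = \int[Q]_(v in D) cst x v.
  by rewrite integral_cst// muleC.
have QDfin : Q D \is a fin_num by rewrite fin_num_measure.
have QDgt0 : 0 < Q D by rewrite lt0e QD0 measure_ge0.
split.
  move=> n; rewrite -(@lee_pmul2l _ (Q D))// Qm// kcst.
  apply: ge0_le_integral => //.
  - by move=> v _; rewrite lee_fin.
  - exact: measurable_funTS (mk _ (mi n)).
  - by move=> v Dv; exact: (kq v Dv).1.
rewrite -(@lee_pmul2l _ (Q D))// [leRHS]kcst.
rewrite -cE -nneseriesZl => [|n _]; last by rewrite mule_ge0// lee_fin.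
have mw n : measurable_fun D (fun v => (w n)%:E * k v (i @^-1` [set n])).
  by apply: measurable_funTS; apply: measurable_funeM; exact: mk.
have -> : \sum_(n <oo) c%:E * ((w n)%:E * m (i @^-1` [set n])) =
    \int[Q]_(v in D) \sum_(n <oo) (w n)%:E * k v (i @^-1` [set n]).
  rewrite integral_nneseries//; last first.
    by move=> n v _; rewrite mule_ge0// lee_fin.
  apply: eq_eseriesr => n _; rewrite muleCA cE Qm// ge0_integralZl//.
    exact: measurable_funTS (mk _ (mi n)).
  by rewrite lee_fin.
apply: ge0_le_integral => //.
- by move=> v _; apply: nneseries_ge0 => n _ _; rewrite mule_ge0// lee_fin.
- have mw' v : D v -> forall n, xpredT n -> 0 <= (w n)%:E * k v (i @^-1` [set n]).
    by move=> _ n _; rewrite mule_ge0// lee_fin.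
  exact: (@ge0_emeasurable_sum _ _ _ _ _ xpredT
    (fun n v Dv _ => mw' v Dv n isT) (fun n _ => mw n)).
- by move=> v Dv; exact: (kq v Dv).2.
Qed.

End profile.

Lemma Lnorm_le_integral d (R : realType) (Y : measurableType d)
    (m : {measure set Y -> \bar R}) (p C : R) (f : Y -> R) : 0 < p ->
  (forall y, 0 <= f y) ->
  ('N[m]_p%:E[EFin \o f] <= C%:E -> \int[m]_y (f y `^ p)%:E <= (C `^ p)%:E)%E.
Proof.
move=> p0 f0 fC.
have -> : (\int[m]_y (f y `^ p)%:E = 'N[m]_p%:E[EFin \o f] `^ p)%E.
  rewrite poweR_Lnorm ?gt_eqF//; apply: eq_integral => y _ /=.
  by rewrite ger0_norm.
by rewrite -poweR_EFin; apply: le_poweR => //; [exact: ltW|exact: Lnorm_ge0].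
Qed.

Lemma Lnorm_cst_le d (R : realType) (Y : measurableType d) (q : probability Y R)
    (p C : R) : 0 < p -> 0 <= C -> ('N[q]_p%:E[EFin \o cst C] <= C%:E)%E.
Proof.
move=> p0 C0; apply: Lnorm_le => //=.
by rewrite integral_cst// [X in (_ * X)%E]probability_setT mule1.
Qed.

(** * Wasserstein distance of an average of probability measures *)

Section average.
Local Open Scope ereal_scope.
Context d (R : realType) (T : borelMetricType d R).
Hypothesis sT : separable_space T.
Variable p : R.
Hypothesis p1 : (1 <= p)%R.

Let p0 : (0 < p)%R. Proof. exact: lt_le_trans p1. Qed.

(** The infimum is finite, being nonnegative and at most [c], so it is approached within [e]; it
    need not be attained. *)
Lemma wasserstein_coupling (m1 m2 : set T -> \bar R) (c e : R) : (0 < e)%R ->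
  wasserstein p m1 m2 <= c%:E ->
  exists2 Pi : probability (T * T)%type R, coupling m1 m2 Pi &
    transport_cost p Pi <= (c + e)%:E.
Proof.
rewrite wassersteinE => e0 Wc.
have Wfin : ereal_inf [set transport_cost p Pi | Pi in coupling m1 m2] \is a fin_num.
  rewrite ge0_fin_numE; first by rewrite (le_lt_trans Wc) ?ltry.
  by apply: le_ereal_inf_tmp => _ [Pi _ <-]; exact: Lnorm_ge0.
have [_ [Pi cPi <-] h] := lb_ereal_inf_adherent e0 Wfin.
exists Pi => //; apply: le_trans (ltW h) _.
by rewrite EFinD leeD2r.
Qed.

(** Minkowski's inequality under the coupling; it transfers finite p-th moments from one marginal to
    the other. *)
Lemma Lnorm_mdist_coupling (x0 : T) (m1 m2 : probability T R)
    (Pi : probability (T * T)%type R) : coupling m1 m2 Pi ->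
  ('N[m1]_p%:E[EFin \o mdist x0] <=
    transport_cost p Pi + 'N[m2]_p%:E[EFin \o mdist x0]) /\
  ('N[m2]_p%:E[EFin \o mdist x0] <=
    transport_cost p Pi + 'N[m1]_p%:E[EFin \o mdist x0]).
Proof.
move=> cPi.
have mf : measurable_fun setT (mdist x0 : T -> R) by exact: measurable_mdist.
have mfp : measurable_fun setT (fun x : T => (mdist x0 x `^ p)%:E : \bar R).
  by apply/measurable_EFinP; apply: (measurableT_comp (measurable_powR p)).
have fp0 (x : T) : 0 <= (mdist x0 x `^ p)%:E :> \bar R by rewrite lee_fin powR_ge0.
have mf1 : measurable_fun setT (fun z : T * T => mdist x0 z.1).
  exact: (measurableT_comp mf measurable_fst).
have mf2 : measurable_fun setT (fun z : T * T => mdist x0 z.2).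
  exact: (measurableT_comp mf measurable_snd).
have md : measurable_fun setT (fun z : T * T => mdist z.1 z.2).
  exact: measurable_fun_mdist.
have -> : 'N[m1]_p%:E[EFin \o mdist x0] =
    'N[Pi]_p%:E[EFin \o (fun z : T * T => mdist x0 z.1)].
  rewrite !LnormE_ge0; [|by move=> z; exact: mdist_ge0..].
  by rewrite (integral_coupling_fst cPi mfp).
have -> : 'N[m2]_p%:E[EFin \o mdist x0] =
    'N[Pi]_p%:E[EFin \o (fun z : T * T => mdist x0 z.2)].
  rewrite !LnormE_ge0; [|by move=> z; exact: mdist_ge0..].
  by rewrite (integral_coupling_snd cPi mfp).
split; apply: le_trans (minkowski_EFin Pi md _ p1) => //.
- apply: le_Lnorm => //; [exact: ltW|exact: measurable_funD| |].
    by move=> z; exact: mdist_ge0.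
  move=> z /=; rewrite addrC (metric_sym z.1); exact: metric_triangle.
- apply: le_Lnorm => //; [exact: ltW|exact: measurable_funD| |].
    by move=> z; exact: mdist_ge0.
  move=> z /=; rewrite addrC; exact: metric_triangle.
Qed.

(** On the cell of x, the distance from [x0] to the centre is at most [mdist x0 x + e]. The sum is
    thus at most the p-th moment of [mdist x0 x + 2 e]. *)
Lemma cell_weight_lty (e : R) (x0 : T) (a : nat -> T) (i : T -> nat)
    (m : probability T R) : (0 < e)%R ->
  (forall n, measurable (i @^-1` [set n])) ->
  (forall x, (mdist (a (i x)) x < e)%R) ->
  'N[m]_p%:E[EFin \o mdist x0] < +oo ->
  \sum_(k <oo) (cell_weight p e x0 a k)%:E * m (i @^-1` [set k]) < +oo.
Proof.
move=> e0 mi ai moo.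
have e20 : (0 <= e + e)%R by rewrite addr_ge0// ltW.
rewrite -(@integral_index _ _ _ m i (fun k => (cell_weight p e x0 a k)%:E))//; last first.
  by move=> n; rewrite lee_fin powR_ge0.
have mf : measurable_fun setT (mdist x0 : T -> R) by exact: measurable_mdist.
have mg : measurable_fun setT (mdist x0 \+ cst (e + e) : T -> R)%R.
  exact: measurable_funD.
have g0 y : (0 <= (mdist x0 \+ cst (e + e)%R : T -> R) y)%R.
  by rewrite addr_ge0// mdist_ge0.
apply: (@le_lt_trans _ _
    (\int[m]_x (((mdist x0 \+ cst (e + e) : T -> R) x) `^ p)%:E)).
  apply: ge0_le_integral => //.
  - by move=> x _; rewrite lee_fin powR_ge0.
  - apply/measurable_EFinP.
    exact: (@measurable_fun_index _ _ _ _ i (cell_weight p e x0 a) mi).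
  - by apply/measurable_EFinP; apply: (measurableT_comp (measurable_powR p)).
  - move=> x _; rewrite lee_fin; apply: ge0_ler_powR; rewrite ?nnegrE ?(ltW p0)//.
      by rewrite addr_ge0 ?mdist_ge0 ?ltW.
    rewrite /= addrA lerD2r.
    apply: le_trans (metric_triangle _ x _) _.
    by rewrite lerD2l metric_sym ltW.
apply: (@lty_poweRy _ _ p^-1); first by rewrite invr_neq0 ?gt_eqF.
rewrite -LnormE_ge0//; apply: le_lt_trans (minkowski_EFin m mf _ p1) _ => //.
rewrite lte_add_pinfty// (le_lt_trans (Lnorm_cst_le m p0 e20))//.
by rewrite ltry.
Qed.

Lemma measurable_in_profile dO (Omega : measurableType dO) (k : Omega -> probability T R)
    (e : R) (x0 : T) (a : nat -> T) (i : T -> nat) (q : nat -> R) :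
  (forall n, measurable (i @^-1` [set n])) ->
  (forall A, measurable A -> measurable_fun setT (fun v => k v A)) ->
  measurable [set v | in_profile p e x0 a i q (k v)].
Proof.
move=> mi mk.
pose f v := \sum_(n <oo) (cell_weight p e x0 a n)%:E * k v (i @^-1` [set n]).
pose K := \sum_(n <oo) (q n * cell_weight p e x0 a n)%:E + (e `^ p)%:E.
have mf : measurable_fun setT f.
  apply: (@ge0_emeasurable_sum _ _ _ _ _ xpredT) => [n v _ _|n _].
    by rewrite mule_ge0// lee_fin powR_ge0.
  by apply: measurable_funeM; exact: mk.
have -> : [set v | in_profile p e x0 a i q (k v)] =
    (\bigcap_n ((fun v => k v (i @^-1` [set n])) @^-1` `[(q n)%:E, +oo])) `&`
    f @^-1` `[-oo, K].
  apply/seteqP; split => v /=.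
    move=> [h1 h2]; split.
      by move=> n _ /=; rewrite in_itv/= h1 leey.
    by rewrite in_itv/= leNye.
  move=> [h1]; rewrite in_itv/= leNye => h2; split => // n.
  by have := h1 n I; rewrite /= in_itv/= => /andP[].
apply: measurableI.
  apply: bigcapT_measurable => n; rewrite -[X in measurable X]setTI.
  by apply: mk => //; exact: emeasurable_itv.
by rewrite -[X in measurable X]setTI; apply: mf => //; exact: emeasurable_itv.
Qed.

(** Convexity of the p-th power of the Wasserstein distance, obtained with one coupling per piece of
    a countable partition instead of one per point [v]. *)
Lemma wasserstein_average dO (Omega : measurableType dO) (Q : probability Omega R)
    (k : Omega -> probability T R) (rho : Omega -> R) (x0 : T)
    (pi : probability T R) (nu : set T -> \bar R) :
  (forall A, measurable A -> measurable_fun setT (fun v => k v A)) ->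
  measurable_fun setT rho -> (forall v, (0 <= rho v)%R) ->
  (forall v, wasserstein p (k v) pi <= (rho v)%:E) ->
  'N[pi]_p%:E[EFin \o mdist x0] < +oo ->
  (forall A, measurable A -> nu A = \int[Q]_v k v A) ->
  wasserstein p nu pi <= 'N[Q]_p%:E[EFin \o rho].
Proof.
move=> mk mrho rho0 Wk pioo nuE; apply/lee_addgt0Pr => eta eta0.
(* The budget of [8 * e]: one [e] for a near-optimal coupling, [6 * e] for passing to the average
   over the piece, one [e] for the variation of [rho] on it. *)
pose e : R := (eta / 8)%R.
have e0 : (0 < e)%R by rewrite divr_gt0.
have [a [i [mi ai]]] := index_of_cells x0 sT e0.
have kw v : \sum_(n <oo) (cell_weight p e x0 a n)%:E * k v (i @^-1` [set n]) < +oo.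
  apply: cell_weight_lty => //.
  have [Pi cPi Pie] := wasserstein_coupling e0 (Wk v).
  apply: le_lt_trans (Lnorm_mdist_coupling x0 cPi).1 _.
  by rewrite lte_add_pinfty// (le_lt_trans Pie)// ltry.
(* The second component fixes the integer part of [rho v / e], so [rho] varies by at most [e] on the
   set. *)
pose good (c : (seq nat * nat) * nat) : set Omega :=
  [set v | in_profile p e x0 a i (grid R c.1) (k v)] `&`
  [set v | Num.truncn (rho v / e) = c.2].
have mgood c : measurable (good c).
  apply: measurableI; first exact: measurable_in_profile.
  have -> : [set v | Num.truncn (rho v / e) = c.2] =
      rho @^-1` [set` `[c.2%:R * e, c.2.+1%:R * e[%R].
    have re0 v : (0 <= rho v / e)%R by exact: divr_ge0 (rho0 v) (ltW e0).
    by apply/seteqP; split => v /=;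
      rewrite in_itv/= -ler_pdivlMr// -ltr_pdivrMr// -truncn_eq// => /eqP.
  by rewrite -[X in measurable X]setTI; exact: mrho.
(* Codes are enumerated by integers; an integer that codes nothing gets the empty set. *)
pose E n : set Omega := if unpickle n is Some c then good c else set0.
have [||j mj Ej] := @measurable_selector _ _ E.
- by move=> n; rewrite /E; case: unpickle.
- move=> v; have [c cv] := grid_in_profile e0 mi (kw v).
  by exists (pickle (c, Num.truncn (rho v / e))); rewrite /E pickleK.
pose B n := j @^-1` [set n].
(* The coupling is quantified before [v0], so it depends on the piece alone and can be chosen for
   every [n], empty pieces included. *)
have piece n : exists Pi : probability (T * T)%type R, forall v0, B n v0 ->
    exists m : probability T R,
      [/\ forall A, measurable A -> Q (B n) * m A = \int[Q]_(v in B n) k v A,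
          coupling m pi Pi
        & forall v, B n v -> transport_cost p Pi <= (rho v + 8 * e)%:E].
  have [[v0 Bv0]|Bn0] := pselect (exists v, B n v); last first.
    (* On an empty piece any probability measure will do. *)
    by exists (\d_(x0, x0))%R => v Bv; case: Bn0; exists v.
  have : E (j v0) v0 := Ej v0.
  rewrite /E Bv0; case un: (unpickle n) => [c|//] [_ cv0].
  have goodB v : B n v -> good c v by move=> jv; have := Ej v; rewrite /E jv un.
  have [m Qm mnear] := in_profile_average mi Q (grid_ge0 R c.1) (grid_lty p e x0 a c.1) mk
    (mj n) Bv0 (fun v Bv => (goodB v Bv).1).
  (* A near-optimal coupling at the single point [v0] is transferred to the average [m]. *)
  have [Pi0 cPi0 Pi0e] := wasserstein_coupling e0 (Wk v0).
  have [Pi cPi Pie] := in_profile_coupling sT p1 e0 mi ai (grid_ge0 R c.1)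
    (grid_lty p e x0 a c.1) (goodB _ Bv0).1 mnear cPi0.
  exists Pi => _ _; exists m; split => // v Bv.
  apply: le_trans Pie _; apply: le_trans (leeD2r _ Pi0e) _.
  rewrite -EFinD lee_fin.
  have rr u : (0 <= rho u / e)%R by rewrite divr_ge0// ltW.
  have /andP[_ h0] := truncn_itv (rr v0).
  have /andP[h1 _] := truncn_itv (rr v).
  have [_ /= c2] := goodB _ Bv.
  rewrite c2 in h1; rewrite [Num.truncn _]cv0 in h0.
  have : (rho v0 / e <= rho v / e + 1)%R.
    by rewrite (le_trans (ltW h0))// -natr1 lerD2r.
  rewrite ler_pdivrMr// mulrDl mul1r divfK ?gt_eqF//; lra.
have [Pi_ PiP] := choice piece.
(* The kernel of couplings takes countably many values on measurable pieces, so its measurability is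
   immediate. *)
pose PiO v : {measure set (T * T) -> \bar R} := Pi_ (j v).
have mPiO A : measurable A -> measurable_fun setT (PiO ^~ A).
  by move=> mA; exact: (@measurable_fun_index _ _ _ _ j (fun n => Pi_ n A) mj).
have [M [ME MI]] := mixture_ex Q mPiO.
have M_fst A : measurable A -> M (fst @^-1` A) = nu A.
  move=> mA; rewrite ME nuE//.
  rewrite (@integral_index _ _ _ Q j (fun n => Pi_ n (fst @^-1` A)))//.
  have jT : \bigcup_n B n = setT.
    by apply/seteqP; split => // v _; exists (j v).
  (* On each piece [Q (B n) * m A] is the integral of [k v A]; summing over the pieces recovers
     [nu A]. *)
  rewrite -jT ge0_integral_bigcup//; first last.
  - by move=> n1 n2 _ _ [v [/= <- <-]].
  - by rewrite jT; exact: mk.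
  apply: eq_eseriesr => n _.
  have [[v Bv]|Bn0] := pselect (exists v, B n v).
    by have [m [<-// cm _]] := PiP n v Bv; rewrite muleC (cm A mA).1.
  have B0 : j @^-1` [set n] = set0.
    by apply/seteqP; split => // v Bv; apply: Bn0; exists v.
  by rewrite /B B0 integral_set0 measure0 mule0.
have M_snd A : measurable A -> M (snd @^-1` A) = pi A.
  move=> mA; rewrite ME.
  transitivity (\int[Q]_v cst (pi A) v).
    apply: eq_integral => v _; have [m [_ cm _]] := PiP (j v) v erefl.
    exact: (cm A mA).2.
  by rewrite integral_cst// [X in _ * X]probability_setT mule1.
have M1 : M setT = 1.
  by rewrite -(preimage_setT snd) M_snd//; exact: probability_setT.
have [Pi PiE] := probability_ex M1.
have cPi : coupling nu pi Pi by move=> A mA; rewrite PiE M_fst// M_snd.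
rewrite wassersteinE; apply: (@le_trans _ _ (transport_cost p Pi)).
  by apply: ereal_inf_lbound; exists Pi.
have mg : measurable_fun setT (rho \+ cst (8 * e) : Omega -> R)%R.
  exact: measurable_funD.
have g0 v : (0 <= (rho \+ cst (8 * e)%R : Omega -> R) v)%R.
  by rewrite addr_ge0// mulr_ge0// ltW.
have mdp : measurable_fun setT (fun z : T * T => (mdist z.1 z.2 `^ p)%:E : \bar R).
  apply/measurable_EFinP; apply: (measurableT_comp (measurable_powR p)).
  exact: measurable_fun_mdist.
have dp0 (z : T * T) : 0 <= (mdist z.1 z.2 `^ p)%:E :> \bar R.
  by rewrite lee_fin powR_ge0.
(* The cost at [v] is at most [rho v + 8 * e]. Its p-th power is integrated over [Q], and
   Minkowski's inequality in [Q] then splits off [8 * e], which equals [eta]. *)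
apply: (@le_trans _ _ 'N[Q]_p%:E[EFin \o (rho \+ cst (8 * e) : Omega -> R)%R]).
  rewrite /transport_cost !LnormE_ge0//; last by move=> z; exact: mdist_ge0.
  apply: le_poweR; [by rewrite invr_ge0 ltW|exact: integral_ge0|].
  have -> : \int[Pi]_z (mdist z.1 z.2 `^ p)%:E = \int[M]_z (mdist z.1 z.2 `^ p)%:E.
    by apply: eq_measure_integral => A _ _; rewrite -PiE.
  rewrite MI//; apply: ge0_le_integral => //.
  - by move=> v _; exact: integral_ge0.
  - by apply: measurable_fun_integral_kernel.
  - by apply/measurable_EFinP; apply: (measurableT_comp (measurable_powR p)).
  - move=> v _; have [m [_ _ h]] := PiP (j v) v erefl.
    by apply: Lnorm_le_integral => //; [move=> z; exact: mdist_ge0|exact: h].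
apply: le_trans (minkowski_EFin Q mrho _ p1) _ => //.
rewrite leeD2l// (le_trans (Lnorm_cst_le Q p0 _))//.
  by rewrite mulr_ge0// ltW.
by rewrite lee_fin /e mulrC divfK.
Qed.

End average.

(** * Application to the subordinate process *)

(** Change of variables from the law of [S t] to [Q]; as [S t] is nonnegative at every sample point,
    the preimage of the half-line is the whole space. *)
Lemma subordinate_transition_average d dO dS (R : realType) (T : borelMetricType d R)
    (Omega : measurableType dO) (OmegaS : measurableType dS)
    (Q : probability OmegaS R) (P : T -> probability Omega R)
    (X : R -> {mfun Omega >-> T}) (F : R -> set (set Omega))
    (S : R -> {RV Q >-> R}) (t : R) (x : T) (B : set T) :
  strong_markov_process P X F -> subordinator S -> 0 <= t -> measurable B ->
  subordinate_transition P X S t x B = (\int[Q]_v transition P X (S t v) x B)%E.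
Proof.
move=> mX sS t0 mB; rewrite /subordinate_transition.
rewrite {1}/distribution ge0_integral_pushforward//=; last exact: measurable_transition mX mB.
have -> : S t @^-1` `[0, +oo[ = setT; last by [].
by apply/seteqP; split => // v _ /=; rewrite in_itv/= (subordinator_ge0 sS).
Qed.

Lemma measurable_subordinate_time dS (R : realType) (OmegaS : measurableType dS)
    (Q : probability OmegaS R) (S : R -> {RV Q >-> R}) (t : R)
    d' (Z : measurableType d') (f : R -> Z) :
  subordinator S -> 0 <= t ->
  measurable_fun (`[0, +oo[%classic : set R) f ->
  measurable_fun setT (fun v => f (S t v)).
Proof.
move=> sS t0 mf; apply: (measurable_comp _ _ mf) => //.
by move=> _ [v _ <-] /=; rewrite in_itv/= (subordinator_ge0 sS).
Qed.

(** At time 0 the transition law is the Dirac mass at [x], whose p-th moment about [x] is 0. A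
    coupling of finite cost then bounds the moment of [pi]. *)
Lemma invariant_moment d dO (R : realType) (T : borelMetricType d R)
    (Omega : measurableType dO) (P : T -> probability Omega R)
    (X : R -> {mfun Omega >-> T}) (F : R -> set (set Omega))
    (pi : probability T R) (p C : R) (x : T) :
  separable_space T -> strong_markov_process P X F -> 1 <= p ->
  (wasserstein p (transition P X 0 x) pi <= C%:E)%E ->
  ('N[pi]_p%:E[EFin \o mdist x] < +oo)%E.
Proof.
move=> sT mX p1 WC.
have p0 : 0 < p by exact: lt_le_trans p1.
have [Pi cPi PiC] := wasserstein_coupling (ltr01 : 0 < 1 :> R) WC.
apply: le_lt_trans (Lnorm_mdist_coupling sT p1 x cPi).2 _.
rewrite lte_add_pinfty//; first by rewrite (le_lt_trans PiC)// ltry.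
have mf : measurable_fun setT (fun y : T => (mdist x y `^ p)%:E : \bar R).
  apply/measurable_EFinP; apply: (measurableT_comp (measurable_powR p)).
  exact: measurable_mdist.
rewrite (@le_lt_trans _ _ 0%E)//; apply: Lnorm_le => //.
  by move=> y; exact: mdist_ge0.
rewrite powR0 ?gt_eqF//.
rewrite /transition ge0_integral_distribution//; last first.
  by move=> y; rewrite lee_fin powR_ge0.
have mx : measurable [set x].
  have -> : [set x] = mdist x @^-1` [set 0 : R].
    by apply/seteqP; split => [y /= ->|y /= /mdist_positivity//]; exact: mdistxx.
  by rewrite -[X in measurable X]setTI; exact: measurable_mdist.
have mX0 : measurable (X 0 @^-1` [set x]).
  by rewrite -[X in measurable X]setTI; exact: (measurable_funP (X 0)).
(* The integrand vanishes where [X 0] equals [x], and the complement is negligible. *)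
have null : P x (~` (X 0 @^-1` [set x])) = 0%E.
  by rewrite probability_setC// (markov_start mX) subee.
rewrite (@ge0_negligible_integral _ _ _ _ setT (~` (X 0 @^-1` [set x])))//; last 3 first.
- exact: measurableC.
- exact: (measurableT_comp mf).
- by move=> w _; rewrite lee_fin powR_ge0.
rewrite integral0_eq// => w /= [_ /contrapT ->].
by rewrite mdistxx powR0 ?gt_eqF.
Qed.

Theorem proposition1p1 (R : realType) (d dO dS : measure_display)
    (T : borelMetricType d R)
    (Omega : measurableType dO) (P : T -> probability Omega R)
    (X : R -> {mfun Omega >-> T}) (F : R -> set (set Omega))
    (OmegaS : measurableType dS) (Q : probability OmegaS R)
    (S : R -> {RV Q >-> R}) (psi : R -> R)
    (pi : probability T R) (p : R) (r : R -> R) (c : T -> R)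
    (T_locally_compact : locally_compact [set: T])
    (T_separable : separable_space T)
    (T_completely_metrizable : completely_metrizable R T)
    (X_markov : strong_markov_process P X F)
    (S_subordinator : subordinator S)
    (S_psi : characteristic_exponent S psi)
    (pi_invariant : invariant_measure P X pi)
    (p_ge1 : 1 <= p)
    (r_measurable : measurable_fun (`[0, +oo[%classic : set R) r)
    (r_ge1 : forall t : R, 0 <= t -> 1 <= r t)
    (c_ge0 : forall x : T, 0 <= c x)
    (rate : forall (t : R) (x : T), 0 <= t ->
      (wasserstein p (transition P X t x) pi <= (c x * r t)%:E)%E) :
  forall (t : R) (x : T), 0 <= t ->
    (wasserstein p (subordinate_transition P X S t x) pi
       <= (c x)%:E * subordinate_rate S p r t)%E.
Proof.
move=> t x t0.
have p0 : 0 < p by exact: lt_le_trans p_ge1.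
have S0 v : 0 <= S t v by exact: subordinator_ge0.
have r0 v : 0 <= r (S t v) by rewrite (le_trans ler01)// r_ge1.
have mr : measurable_fun setT (fun v => r (S t v)).
  exact: (measurable_subordinate_time S_subordinator t0 r_measurable).
have mrp : measurable_fun setT (fun v => (r (S t v) `^ p)%:E : \bar R).
  by apply/measurable_EFinP; apply: (measurableT_comp (measurable_powR p)).
pose k v : probability T R := transition P X (S t v) x.
have mk A : measurable A -> measurable_fun setT (fun v => k v A).
  move=> mA; apply: (measurable_subordinate_time (f := fun s => transition P X s x A)) => //.
  exact: measurable_transition X_markov mA.
(* The base point for the moments is the starting point [x] itself, so the rate at time 0
   applies. *)
have pioo := invariant_moment T_separable X_markov p_ge1 (rate 0 x (lexx 0)).
pose rho v := c x * r (S t v).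
have mrho : measurable_fun setT rho by exact: measurable_funM.
have rho0 v : 0 <= rho v by rewrite mulr_ge0.
have Wk v : (wasserstein p (k v) pi <= (rho v)%:E)%E by exact: rate.
have nuE A : measurable A ->
    subordinate_transition P X S t x A = (\int[Q]_v k v A)%E.
  exact: (subordinate_transition_average x X_markov S_subordinator t0).
apply: le_trans (wasserstein_average T_separable p_ge1 mk mrho rho0 Wk pioo nuE) _.
rewrite LnormE_ge0// /subordinate_rate unlock.
(* The factor [c x] is constant in the sample point and leaves the p-norm by homogeneity. *)
have -> : (\int[Q]_v (rho v `^ p)%:E = (c x `^ p)%:E * \int[Q]_v (r (S t v) `^ p)%:E)%E.
  rewrite -ge0_integralZl//; last 2 first.
  - by move=> v _; rewrite lee_fin powR_ge0.
  - by rewrite lee_fin powR_ge0.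
  by apply: eq_integral => v _; rewrite /rho powRM.
rewrite poweRM ?lee_fin ?powR_ge0//; last first.
  by apply: integral_ge0 => v _; rewrite lee_fin powR_ge0.
by rewrite poweR_EFin -powRrM divff ?gt_eqF// powRr1.
Qed.
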